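(* Let $M$ be a Riemann surface. All strongly isotropic harmonic maps $\varphi:M\to G_k(\mathbb C^n)$ are of finite uniton number.
   Context: Riemann surfaces are connected, as usual; $z$ is a local complex coordinate. Harmonic maps and finite uniton number. A smooth map $\varphi:M\to\mathrm U(n)$ is harmonic iff, with $A^\varphi_z=\frac12\varphi^{-1}\partial_z\varphi$, $A^\varphi_{\bar z}=\frac12\varphi^{-1}\partial_{\bar z}\varphi$, one has $\partial_{\bar z}A^\varphi_z+\partial_zA^\varphi_{\bar z}=0$. An extended solution associated to $\varphi$ is a smooth $\Phi:S^1\times M\to\mathrm U(n)$ with $\Phi(1,\cdot)=I$ and $\Phi^{-1}d\Phi=(1-\lambda^{-1})A^\varphi_z\,dz+(1-\lambda)A^\varphi_{\bar z}\,d\bar z$. $\varphi$ is of finite uniton number if there is an associated extended solution defined on all of $M$ that is a trigonometric polynomial $\sum_{k=-r}^sC_k(z)\lambda^k$ ($C_k$ smooth) in $\lambda\in S^1$. Grassmannians. $G_k(\mathbb C^n)$ is the Grassmannian of $k$-dimensional subspaces of $\mathbb C^n$, embedded in $\mathrm U(n)$ by the totally geodesic Cartan embedding $\alpha\mapsto\pi_\alpha-\pi_\alpha^\perp$ ($\pi_\alpha$ the Hermitian projection onto $\alpha$, $\pi_\alpha^\perp=\pi_{\alpha^\perp}$); harmonicity and finiteness of the uniton number of a map into $G_k(\mathbb C^n)$ are those of its composition with this embedding. Such a map is identified with a rank $k$ subbundle $\varphi$ of $M\times\mathbb C^n$. Gauss bundles. For a subbundle $\varphi$ of $M\times\mathbb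 C^n$, $A'_\varphi:\varphi\to\varphi^\perp$ is $A'_\varphi(s)=\pi_\varphi^\perp\partial_zs$. For harmonic $\varphi$, the Gauss bundle $G'(\varphi)$ is the image of $A'_\varphi$, extended over the isolated points where its rank drops to a subbundle of $M\times\mathbb C^n$; it is again harmonic. Put $G^{(0)}(\varphi)=\varphi$, $G^{(i+1)}(\varphi)=G'(G^{(i)}(\varphi))$. The isotropy order of $\varphi$ is the greatest $t\in\{1,2,\dots,\infty\}$ such that $\varphi$ is orthogonal to $G^{(i)}(\varphi)$ for all $i$ with $1\le i\le t$. $\varphi$ is strongly isotropic if $t=\infty$, i.e. all the Gauss bundles $G^{(i)}(\varphi)$, $i=0,1,2,\dots$, are mutually orthogonal. *)

(* Defs.v *)
From HB Require Import structures.
From mathcomp Require Import all_boot all_order all_algebra.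
From mathcomp Require Import complex.
From mathcomp Require Import all_classical all_reals all_analysis.

Set Implicit Arguments.
Unset Strict Implicit.
Unset Printing Implicit Defensive.

Import Order.TTheory GRing.Theory Num.Theory.
Import numFieldNormedType.Exports.
Local Open Scope classical_set_scope.
Local Open Scope complex_scope.
Local Open Scope ring_scope.

(* mathcomp-analysis topologizes an abstract numFieldType K through K^o; this
   transports that structure to R[i], so that [derivable f z 1] for
   f : R[i] -> R[i] is complex differentiability. *)
HB.instance Definition _ (R : realType) :=
  NormedModule.copy R[i] (R[i] : numClosedFieldType)^o.

Section Calculus.
Context {R : realType}.

(* C^k on an open set of a finite-dimensional V, through directional
   derivatives in all directions. *)
Fixpoint Ck {V : normedModType R} (k : nat) (U : set V) (f : V -> R) : Prop :=
  (forall x, U x -> {for x, continuous f}) /\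
  (if k is k'.+1 then
     forall v, (forall x, U x -> derivable f x v) /\ Ck k' U ('D_v f)
   else True).

Definition Cinfty {V : normedModType R} (U : set V) (f : V -> R) : Prop :=
  forall k, Ck k U f.

Definition mx_Cinfty {V : normedModType R} {m n : nat} (U : set V)
    (F : V -> 'M[R[i]]_(m, n)) : Prop :=
  forall a b, Cinfty U (fun x => complex.Re (F x a b)) /\
              Cinfty U (fun x => complex.Im (F x a b)).

Definition mx_derive {V : normedModType R} {m n : nat} (v : V)
    (F : V -> 'M[R[i]]_(m, n)) (x : V) : 'M[R[i]]_(m, n) :=
  \matrix_(a, b) ('D_v (fun y => complex.Re (F y a b)) x +i*
                  'D_v (fun y => complex.Im (F y a b)) x).

(* The operators d/dz = (d/dx - i d/dy)/2 and d/dzbar = (d/dx + i d/dy)/2. *)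
Definition Dz {m n : nat} (F : R * R -> 'M[R[i]]_(m, n)) (x : R * R) :
    'M[R[i]]_(m, n) :=
  2^-1 *: (mx_derive (1 : R, 0 : R) F x - 'i%C *: mx_derive (0 : R, 1 : R) F x).

Definition Dzbar {m n : nat} (F : R * R -> 'M[R[i]]_(m, n)) (x : R * R) :
    'M[R[i]]_(m, n) :=
  2^-1 *: (mx_derive (1 : R, 0 : R) F x + 'i%C *: mx_derive (0 : R, 1 : R) F x).

Definition C_of_R2 (x : R * R) : R[i] := x.1 +i* x.2.
Definition R2_of_C (z : R[i]) : R * R := (complex.Re z, complex.Im z).

End Calculus.

(* Only the values of coord on dom, and of icoord on coord @` dom, matter. *)
Record chart (R : realType) (M : topologicalType) := Chart {
  dom : set M;
  coord : M -> R[i];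
  icoord : R[i] -> M;
  dom_open : open dom;
  codom_open : open (coord @` dom);
  coordK : forall p, dom p -> icoord (coord p) = p;
  coord_continuous : forall p, dom p -> {for p, continuous coord};
  icoord_continuous :
    forall z, (coord @` dom) z -> {for z, continuous icoord} }.

Record riemann_surface (R : realType) := RiemannSurface {
  rs_space :> topologicalType;
  rs_hausdorff : hausdorff_space rs_space;
  rs_nonempty : [set: rs_space] !=set0;
  rs_connected : connected [set: rs_space];
  atlas : set (chart R rs_space);
  atlas_cover : forall p, exists2 c, atlas c & dom c p;
  atlas_holomorphic : forall c d, atlas c -> atlas d ->
    forall p, dom c p -> dom d p ->
      derivable (fun z : R[i] => coord d (icoord c z)) (coord c p) 1 }.

Section Harmonic.
Context {R : realType} {M : riemann_surface R}.
Local Notation C := R[i].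

Definition local_expr {T : Type} (c : chart R M) (F : M -> T) (x : R * R) : T :=
  F (icoord c (C_of_R2 x)).

Definition chart_image (c : chart R M) : set (R * R) :=
  [set R2_of_C (coord c p) | p in dom c].

Definition smooth {m n : nat} (F : M -> 'M[C]_(m, n)) : Prop :=
  forall c, atlas c -> mx_Cinfty (chart_image c) (local_expr c F).

Definition dz {m n : nat} (c : chart R M) (F : M -> 'M[C]_(m, n)) (p : M) :=
  Dz (local_expr c F) (R2_of_C (coord c p)).

Definition dzbar {m n : nat} (c : chart R M) (F : M -> 'M[C]_(m, n)) (p : M) :=
  Dzbar (local_expr c F) (R2_of_C (coord c p)).

Definition Az {n : nat} (c : chart R M) (phi : M -> 'M[C]_n) (p : M) : 'M[C]_n :=
  2^-1 *: (invmx (phi p) *m dz c phi p).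

Definition Azbar {n : nat} (c : chart R M) (phi : M -> 'M[C]_n) (p : M) :
    'M[C]_n :=
  2^-1 *: (invmx (phi p) *m dzbar c phi p).

Definition harmonic_map {n : nat} (phi : M -> 'M[C]_n) : Prop :=
  [/\ smooth phi,
      forall p, phi p \is unitarymx &
      forall c, atlas c -> forall p, dom c p ->
        dzbar c (Az c phi) p + dz c (Azbar c phi) p = 0].

(* Smoothness of Phi on S^1 x M is tested in the coordinates (theta, x, y),
   lambda = exp (i theta); only |lambda| = 1 is relevant. *)
Definition smooth_loop {n : nat} (Phi : C -> M -> 'M[C]_n) : Prop :=
  forall c, atlas c ->
    mx_Cinfty [set x : R * (R * R) | chart_image c x.2]
      (fun x => local_expr c (Phi (cos x.1 +i* sin x.1)) x.2).

Definition extended_solution {n : nat} (phi : M -> 'M[C]_n)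
    (Phi : C -> M -> 'M[C]_n) : Prop :=
  [/\ smooth_loop Phi,
      forall (l : C) (p : M), `|l| = 1 -> Phi l p \is unitarymx,
      forall p, Phi 1 p = 1%:M &
      forall c, atlas c -> forall (l : C) (p : M), `|l| = 1 -> dom c p ->
        invmx (Phi l p) *m dz c (Phi l) p = (1 - l^-1) *: Az c phi p /\
        invmx (Phi l p) *m dzbar c (Phi l) p = (1 - l) *: Azbar c phi p].

(* T j is the coefficient of lambda^(j - r). *)
Definition trigonometric_polynomial {n : nat} (Phi : C -> M -> 'M[C]_n) : Prop :=
  exists r s : nat, exists T : nat -> M -> 'M[C]_n,
    (forall j, smooth (T j)) /\
    forall (l : C) (p : M), `|l| = 1 ->
      Phi l p = \sum_(0 <= j < (r + s).+1) l ^ (j%:Z - r%:Z) *: T j p.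

Definition finite_uniton_number {n : nat} (phi : M -> 'M[C]_n) : Prop :=
  exists2 Phi, extended_solution phi Phi & trigonometric_polynomial Phi.

End Harmonic.

Section Projections.
Context {R : realType} {n : nat}.
Local Notation C := R[i].

Definition is_hermitian_proj (a : {vspace 'cV[C]_n}) (P : 'M[C]_n) : Prop :=
  [/\ (P ^t*)%sesqui = P, P *m P = P &
      forall v : 'cV[C]_n, v \in a <-> P *m v = v].

Definition hproj (a : {vspace 'cV[C]_n}) : 'M[C]_n :=
  xget 0 [set P | is_hermitian_proj a P].

Lemma hproj_spec (a : {vspace 'cV[C]_n}) : is_hermitian_proj a (hproj a).
Proof.
pose B : 'M[C]_(\dim a, n) := \matrix_i ((vbasis a)`_i)^T.
have memB (v : 'cV[C]_n) : (v \in a) = (v^T <= B)%MS.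
  apply/idP/idP => [/coord_vbasis -> | /submxP[u uB]].
    rewrite linear_sum summx_sub // => i _; rewrite linearZ scalemx_sub //.
    by have := row_sub i B; rewrite rowK.
  rewrite -[v]trmxK uB mulmx_sum_row linear_sum memv_suml // => i _.
  by rewrite linearZ /= rowK trmxK memvZ // vbasis_mem // mem_nth // size_tuple.
pose Q := proj_ortho B.
have QQ : Q *m Q = Q by apply: proj_ortho_proj.
have QE : Q = Q *m (Q ^t*)%sesqui.
  have : Q *m ((1%:M - 1%:M *m Q) ^t*)%sesqui = 0.
    apply/orthomx1P; rewrite orthomx_sym.
    apply: submx_trans (proj_ortho_compl_sub B 1%:M) _.
    by rewrite submx_ortho proj_orthoE.
  rewrite mul1mx linearB /= map_mxB trmx1 map_mx1 mulmxBr mulmx1.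
  by move/eqP; rewrite subr_eq0 => /eqP.
have QH : (Q ^t*)%sesqui = Q.
  rewrite {1}QE trmx_mul map_mxM /= -map_trmx -map_mx_comp.
  by rewrite map_mx_id_in ?trmxK -?QE // => i j /=; rewrite conjCK.
rewrite /hproj; case: xgetP => [P -> //|/(_ Q^T) []].
split.
- by rewrite trmxK -[RHS](congr1 trmx QH) map_trmx trmxK.
- by rewrite -trmx_mul QQ.
- move=> v; rewrite memB; split=> [vB | vQ].
    by rewrite -[v in LHS]trmxK -trmx_mul (proj_ortho_id vB) trmxK.
  by rewrite -vQ trmx_mul trmxK proj_ortho_sub.
Qed.

Definition cartan (a : {vspace 'cV[C]_n}) : 'M[C]_n :=
  hproj a - (1%:M - hproj a).

Definition orthogonal_spaces (a b : {vspace 'cV[C]_n}) : Prop :=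
  forall u v : 'cV[C]_n, u \in a -> v \in b -> (u ^t*)%sesqui *m v = 0.

End Projections.

Section Gauss.
Context {R : realType} {M : riemann_surface R} {n : nat}.
Local Notation C := R[i].

(* A smooth map M -> G_k(C^n), i.e. a rank k subbundle of M x C^n; the smooth
   structure of G_k(C^n) is the one induced by the Cartan embedding. *)
Definition subbundle (k : nat) (phi : M -> {vspace 'cV[C]_n}) : Prop :=
  (forall p, \dim (phi p) = k) /\ smooth (fun p => cartan (phi p)).

Definition smooth_section (phi : M -> {vspace 'cV[C]_n}) (s : M -> 'cV[C]_n) :
    Prop :=
  smooth s /\ forall p, s p \in phi p.

Definition second_ff (c : chart R M) (phi : M -> {vspace 'cV[C]_n})
    (s : M -> 'cV[C]_n) (p : M) : 'cV[C]_n :=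
  (1%:M - hproj (phi p)) *m dz c s p.

(* The fibre at p of the image of A'_phi (it does not depend on the chart c
   around p). *)
Definition second_ff_image (c : chart R M) (phi : M -> {vspace 'cV[C]_n})
    (p : M) : set 'cV[C]_n :=
  [set second_ff c phi s p | s in [set s | smooth_section phi s]].

(* psi = G'(phi): the subbundle agreeing with the image of A'_phi off a set of
   points without accumulation point in M; such a psi is unique. *)
Definition gauss_bundle (phi psi : M -> {vspace 'cV[C]_n}) : Prop :=
  (exists m, subbundle m psi) /\
  forall p, \forall q \near p^', forall c, atlas c -> dom c q ->
    [set v | v \in psi q] = second_ff_image c phi q.

Definition gauss_sequence (phi : M -> {vspace 'cV[C]_n})
    (G : nat -> M -> {vspace 'cV[C]_n}) : Prop :=
  G 0%N = phi /\ forall i, gauss_bundle (G i) (G i.+1).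

(* The isotropy order of phi, the greatest t with phi orthogonal to G^(i)(phi)
   for 1 <= i <= t, is infinite. *)
Definition strongly_isotropic (phi : M -> {vspace 'cV[C]_n}) : Prop :=
  exists2 G, gauss_sequence phi G &
    forall i p, (1 <= i)%N -> orthogonal_spaces (phi p) (G i p).

End Gauss.

(* Main.v *)
Require Import Defs.
From mathcomp Require Import all_boot all_order all_algebra.
From mathcomp Require Import complex.
From mathcomp Require Import all_classical all_reals all_analysis.
From mathcomp Require Import ring.

Set Implicit Arguments.
Unset Strict Implicit.
Unset Printing Implicit Defensive.

Import Order.TTheory GRing.Theory Num.Theory.
Import numFieldNormedType.Exports.
Local Open Scope classical_set_scope.
Local Open Scope complex_scope.
Local Open Scope ring_scope.

(** Let [d] and [d'] stand for d/dz and d/dzbar, let [G 0 = phi], [G 1], [G 2] and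
    so on be the Gauss bundles, and let [P i] be the Hermitian projection onto
    [G i].  Suppose that the [G i] are mutually orthogonal, so that only finitely
    many are nonzero, and put

      delta = G 1 + G 2 + ... + G m,     psi = phi + delta.

    Sections of [G i] are mapped by [d] into [G i + G (i + 1)], and by [d'] into
    [G (i - 1) + G i] when [i] is positive.  Hence [delta] and [psi] are stable
    under [d], while [d'] maps sections of [delta] into sections of [psi].  With
    respect to the splitting of C^n into [delta], [phi] and the orthogonal
    complement of [psi], the only off-diagonal blocks of [d] thus go from [phi]
    to [delta] and from the complement of [psi] to [phi].  Give these three
    summands the weights 1, l^-1 and l^-2:

      Phi l = pi_delta + l^-1 pi_phi + l^-2 pi_(psi^perp).

    Conjugation of [d] by [Phi l] multiplies both blocks by l^-1.  Their sum is
    -[Az], so the logarithmic derivative of [Phi l] is (l^-1 - 1) (-[Az]), that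
    is (1 - l^-1) [Az], as required of an extended solution, and [Phi] is a
    trigonometric polynomial by construction.  The corresponding matrix
    identities are [loop_dz] and [loop_dzbar].

    It remains to derive the two mapping properties and the orthogonality from
    the hypothesis, which only says that [phi] is orthogonal to the later [G i].
    For a section [s = P s] one has (1 - P) d s = (d P) P s, so the image of
    A'_phi is the range of the matrix (d P) P, and everything becomes algebra of
    projections and their derivatives.  The map is harmonic exactly when [P]
    commutes with [d d' P].  From this, [gauss_dz] and [gauss_dzbar] give the
    mapping properties of one step, and [gauss_harmonic] shows that the next
    Gauss bundle is harmonic too.  Orthogonality ([gauss_sequence_orth]) then
    spreads from [phi] to every [G i] by induction: a vector of [G (i + 1)] is a
    derivative of a section of [G i], and [G i] is orthogonal to [G (j - 1)] and
    [G j], hence to the [d']-derivatives of sections of [G j].  Finally, n + 1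
    nonzero mutually orthogonal vectors do not exist in C^n, so some [G (m + 1)]
    vanishes ([gauss_sequence_stops]); its rank is constant, so it vanishes on
    all of M.

    The range of (d P) P is the fibre of the Gauss bundle only off isolated
    points, but identities between smooth functions extend over such points by
    continuity ([eq_of_near_punctured]). *)

(** * Functions of class C^k and symmetry of second derivatives *)

Section RealCk.
Context {R : realType} {V : normedModType R}.
Implicit Types (f g : V -> R) (U W : set V).

Lemma Ck_continuous k U f x : Ck k U f -> U x -> {for x, continuous f}.
Proof. by case: k => [|k] [+ _]; exact. Qed.

Lemma Ck_derivable k U f x v : Ck k.+1 U f -> U x -> derivable f x v.
Proof. by move=> [_ /(_ v)[+ _]]; exact. Qed.

Lemma Ck_derive k U f v : Ck k.+1 U f -> Ck k U ('D_v f).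
Proof. by move=> [_ /(_ v)[]]. Qed.

Lemma CkS k U f :
  (forall x, U x -> {for x, continuous f}) ->
  (forall v x, U x -> derivable f x v) -> (forall v, Ck k U ('D_v f)) ->
  Ck k.+1 U f.
Proof. by move=> cf df kf; split=> // v; split=> // x; exact: df. Qed.

Lemma Ck_pred k U f : Ck k.+1 U f -> Ck k U f.
Proof.
elim: k f => [|k IH] f kf; first by split=> // x; exact: Ck_continuous kf.
apply: CkS => [x Ux|v x Ux|v]; first exact: Ck_continuous kf Ux.
  exact: Ck_derivable kf Ux.
exact/IH/Ck_derive.
Qed.

Lemma near_open_eq U f g x : open U -> {in U, f =1 g} -> U x ->
  {near x, f =1 g}.
Proof.
move=> oU fg Ux; near=> y; apply: fg; rewrite inE.
by near: y; exact: open_nbhs_nbhs.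
Unshelve. all: by end_near. Qed.

Lemma derive_open_eq U f g x v : open U -> {in U, f =1 g} -> U x ->
  'D_v f x = 'D_v g x.
Proof.
move=> oU fg Ux; have [->|v0] := eqVneq v 0; first by rewrite !derive0.
by apply: near_eq_derive => //; exact: near_open_eq oU fg Ux.
Qed.

Lemma derivable_open_eq U f g x v : open U -> {in U, f =1 g} -> U x ->
  derivable f x v -> derivable g x v.
Proof.
move=> oU fg Ux; have [->|v0] := eqVneq v 0; first by move=> _; exact: derivable0.
by apply: near_eq_derivable => //; exact: near_open_eq oU fg Ux.
Qed.

(** [Ck] constrains the iterated derivatives at the points of [U], and those
    depend on [f] near these points; on an open set the values of [f] on the set
    determine them. *)
Lemma Ck_open_eq k U f g : open U -> {in U, f =1 g} -> Ck k U f -> Ck k U g.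
Proof.
move=> oU; have cfg f' g' : {in U, f' =1 g'} ->
    (forall x, U x -> {for x, continuous f'}) ->
    forall x, U x -> {for x, continuous g'}.
  move=> fg cf x Ux; rewrite /prop_for /continuous_at -fg ?inE//.
  apply: cvg_trans (cf x Ux); apply: near_eq_cvg.
  exact: near_open_eq oU fg Ux.
elim: k f g => [|k IH] f g fg kf.
  by split=> //; apply: cfg fg _ => y Uy; exact: Ck_continuous kf Uy.
apply: CkS => [|v x Ux|v].
- by apply: cfg fg _ => y Uy; exact: Ck_continuous kf Uy.
- by apply: (derivable_open_eq oU fg Ux); exact: Ck_derivable kf Ux.
- apply: IH (Ck_derive v kf) => x; rewrite inE => Ux.
  exact: derive_open_eq oU fg Ux.
Qed.

Lemma Ck_subset k U W f : U `<=` W -> Ck k W f -> Ck k U f.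
Proof.
move=> UW; elim: k f => [|k IH] f kf.
  by split=> // x /UW Wx; exact: Ck_continuous kf Wx.
apply: CkS => [x /UW Wx|v x /UW Wx|v].
- exact: Ck_continuous kf Wx.
- exact: Ck_derivable kf Wx.
- exact/IH/Ck_derive.
Qed.

Lemma Ck_cst k U (a : R) : Ck k U (cst a).
Proof.
elim: k a => [|k IH] a; first by split=> // x _; exact: cvg_cst.
apply: CkS => [x _|v x _|v]; first exact: cvg_cst.
  exact: derivable_cst.
suff -> : 'D_v (cst a) = cst (0 : R) :> (V -> R) by exact: IH.
by apply/funext => x; exact: derive_cst.
Qed.

Lemma CkD k U f g : open U -> Ck k U f -> Ck k U g -> Ck k U (f \+ g).
Proof.
move=> oU; elim: k f g => [|k IH] f g kf kg.
  split=> // x Ux; apply: continuousD; first exact: Ck_continuous kf Ux.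
  exact: Ck_continuous kg Ux.
apply: CkS => [x Ux|v x Ux|v].
- apply: continuousD; first exact: Ck_continuous kf Ux.
  exact: Ck_continuous kg Ux.
- apply: derivableD; first exact: Ck_derivable kf Ux.
  exact: Ck_derivable kg Ux.
- apply: Ck_open_eq (IH _ _ (Ck_derive v kf) (Ck_derive v kg)) => // x.
  rewrite inE => Ux; rewrite [RHS]deriveD//; first exact: Ck_derivable kf Ux.
  exact: Ck_derivable kg Ux.
Qed.

Lemma CkM k U f g : open U -> Ck k U f -> Ck k U g -> Ck k U (f \* g).
Proof.
move=> oU; elim: k f g => [|k IH] f g kf kg.
  split=> // x Ux; apply: continuousM; first exact: Ck_continuous kf Ux.
  exact: Ck_continuous kg Ux.
apply: CkS => [x Ux|v x Ux|v].
- apply: continuousM; first exact: Ck_continuous kf Ux.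
  exact: Ck_continuous kg Ux.
- apply: derivableM; first exact: Ck_derivable kf Ux.
  exact: Ck_derivable kg Ux.
- have := CkD oU (IH _ _ (Ck_pred kf) (Ck_derive v kg))
                 (IH _ _ (Ck_pred kg) (Ck_derive v kf)).
  apply: Ck_open_eq => // x; rewrite inE => Ux.
  rewrite [RHS]deriveM//; first exact: Ck_derivable kf Ux.
  exact: Ck_derivable kg Ux.
Qed.

Lemma Cinfty_continuous U f x : Cinfty U f -> U x -> {for x, continuous f}.
Proof. by move=> /(_ 0%N); exact: Ck_continuous. Qed.

Lemma Cinfty_derivable U f x v : Cinfty U f -> U x -> derivable f x v.
Proof. by move=> /(_ 1%N); exact: Ck_derivable. Qed.

Lemma Cinfty_derive U f v : Cinfty U f -> Cinfty U ('D_v f).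
Proof. by move=> Uf k; exact: Ck_derive. Qed.

Lemma Cinfty_open_eq U f g : open U -> {in U, f =1 g} ->
  Cinfty U f -> Cinfty U g.
Proof. by move=> oU fg Uf k; exact: Ck_open_eq (Uf k). Qed.

Lemma Cinfty_cst U (a : R) : Cinfty U (cst a).
Proof. by move=> k; exact: Ck_cst. Qed.

Lemma CinftyD U f g : open U -> Cinfty U f -> Cinfty U g -> Cinfty U (f \+ g).
Proof. by move=> oU Uf Ug k; exact: CkD. Qed.

Lemma CinftyM U f g : open U -> Cinfty U f -> Cinfty U g -> Cinfty U (f \* g).
Proof. by move=> oU Uf Ug k; exact: CkM. Qed.

Lemma CinftyN U f : open U -> Cinfty U f -> Cinfty U (\- f).
Proof.
move=> oU Uf; have := CinftyM oU (Cinfty_cst U (-1)) Uf.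
by apply: Cinfty_open_eq => // x _; rewrite /= mulN1r.
Qed.

End RealCk.

Section MixedPartials.
Context {R : realType} {V : normedModType R}.
Implicit Types (f : V -> R) (U : set V).

Lemma is_derive_line f (y v : V) (s : R) : derivable f (s *: v + y) v ->
  is_derive s 1 (fun t : R => f (t *: v + y)) ('D_v f (s *: v + y)).
Proof.
rewrite /derivable /derive; set q := (X in X @ _).
have qE : q = fun h => h^-1 *: (((fun t : R => f (t *: v + y)) \o shift s) (h *: 1)
                 - f (s *: v + y)).
  by apply/funext => h; rewrite /q /= [h *: 1]mulr1 scalerDl addrA.
by rewrite qE => cq; apply: DeriveDef.
Qed.

(** The second difference of [f] over the parallelogram on [h v] and [h w] is
    symmetric in [v] and [w], and two applications of the mean value theorem
    evaluate it as a mixed derivative: this is what makes mixed derivatives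
    commute. *)
Lemma second_difference U f x v w (h : R) : Ck 2 U f -> 0 < h ->
  (forall s t : R, 0 <= s <= h -> 0 <= t <= h -> U (s *: v + (t *: w + x))) ->
  exists s t : R, [/\ 0 <= s <= h, 0 <= t <= h &
    f (h *: v + (h *: w + x)) - f (h *: v + x) - (f (h *: w + x) - f x) =
    'D_w ('D_v f) (s *: v + (t *: w + x)) * h * h].
Proof.
move=> kf h0 hU.
have lin (g dg : R -> R) :
    (forall s : R, 0 <= s <= h -> is_derive s 1 g (dg s)) ->
    exists2 s : R, 0 <= s <= h & g h - g 0 = dg s * h.
  move=> gdg; have [||s] := @MVT _ g dg 0 h h0.
  - by move=> s; rewrite in_itv /= => /andP[s0 sh]; apply: gdg; rewrite !ltW.
  - apply: derivable_within_continuous => s; rewrite in_itv /= => sh.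
    by have [] := gdg s sh.
  - by rewrite in_itv /= subr0 => /andP[s0 sh] ->; exists s => //; rewrite !ltW.
have U0 s : 0 <= s <= h -> U (s *: v + x).
  by move=> sh; have := hU s 0 sh; rewrite scale0r add0r lexx ltW//; exact.
have Uh s : 0 <= s <= h -> U (s *: v + (h *: w + x)).
  by move=> sh; apply: hU => //; rewrite lexx ltW.
have [s sh e1] := lin (fun s => f (s *: v + (h *: w + x)) - f (s *: v + x))
  (fun s => 'D_v f (s *: v + (h *: w + x)) - 'D_v f (s *: v + x))
  (fun s sh => is_deriveB (is_derive_line (Ck_derivable kf (Uh s sh)))
                          (is_derive_line (Ck_derivable kf (U0 s sh)))).
have [t th e2] : exists2 t : R, 0 <= t <= h &
    'D_v f (s *: v + (h *: w + x)) - 'D_v f (s *: v + x) =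
    'D_w ('D_v f) (s *: v + (t *: w + x)) * h.
  have dt t : 0 <= t <= h -> is_derive t 1 (fun t : R => 'D_v f (t *: w + (s *: v + x)))
      ('D_w ('D_v f) (t *: w + (s *: v + x))).
    move=> th; apply: is_derive_line; rewrite addrCA.
    exact: Ck_derivable (Ck_derive v kf) (hU s t sh th).
  have [t th] := lin _ _ dt.
  by rewrite scale0r add0r !(addrCA _ (s *: v)) => e; exists t.
exists s, t; split=> //; rewrite -e2 -e1.
by rewrite !scale0r !add0r.
Qed.

(** Schwarz: both mixed derivatives are limits of the same second difference
    divided by h^2. *)
Lemma derive_comm U f x v w : open U -> Ck 2 U f -> U x ->
  'D_w ('D_v f) x = 'D_v ('D_w f) x.
Proof.
move=> oU kf Ux; apply/eqP; rewrite -subr_eq0 -normr_le0.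
apply/ler_addgt0Pr => e e0; rewrite add0r.
have cvw : {for x, continuous ('D_w ('D_v f))}.
  exact: Ck_continuous (Ck_derive w (Ck_derive v kf)) Ux.
have cwv : {for x, continuous ('D_v ('D_w f))}.
  exact: Ck_continuous (Ck_derive v (Ck_derive w kf)) Ux.
have e2 : 0 < e / 2 by rewrite divr_gt0.
have near_x : \forall y \near x, [/\ U y,
    `|'D_w ('D_v f) x - 'D_w ('D_v f) y| < e / 2 &
    `|'D_v ('D_w f) x - 'D_v ('D_w f) y| < e / 2].
  move/cvgrPdist_lt : cvw => /(_ _ e2) nvw.
  move/cvgrPdist_lt : cwv => /(_ _ e2) nwv.
  have nU : \forall y \near x, U y by exact: open_nbhs_nbhs.
  by apply: filterS3 nU nvw nwv => y a b c; exact: And3 a b c.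
have [d /= d0 dP] := (@nbhs_ballP _ _ _ _).1 near_x.
(* A step small enough for the parallelogram to lie in the ball of radius [d];
   the summand 1 takes care of [v = w = 0]. *)
pose h := d / 2 / (1 + `|v| + `|w|).
have N0 : 0 < 1 + `|v| + `|w| by rewrite ltr_wpDr// ltr_wpDr.
have h0 : 0 < h by rewrite !divr_gt0.
have hd s t : 0 <= s <= h -> 0 <= t <= h -> ball x d (s *: v + (t *: w + x)).
  move=> /andP[s0 sh] /andP[t0 th]; rewrite -ball_normE /ball_ /=.
  rewrite addrA opprD addrCA subrr addr0 normrN.
  apply: (le_lt_trans (ler_normD _ _)); rewrite !normrZ !ger0_norm//.
  apply: (@le_lt_trans _ _ (h * (1 + `|v| + `|w|))).
    rewrite !mulrDr mulr1 -addrA; apply: ler_wpDl; first exact: ltW.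
    by apply: lerD; exact: ler_wpM2r.
  by rewrite /h divfK ?gt_eqF// gtr_pMr// invf_lt1// ltr1n.
have [s [t [sh th est]]] := second_difference kf h0 (fun s t sh th =>
  let: And3 Uy _ _ := dP _ (hd s t sh th) in Uy).
have hd' s' t' : 0 <= s' <= h -> 0 <= t' <= h -> ball x d (s' *: w + (t' *: v + x)).
  by move=> sh' th'; rewrite addrCA; exact: hd.
have [s' [t' [sh' th' est']]] := second_difference kf h0 (fun s t sh th =>
  let: And3 Uy _ _ := dP _ (hd' s t sh th) in Uy).
have hn0 : h != 0 by rewrite gt_eqF.
have [_ a _] := dP _ (hd s t sh th); have [_ _ b] := dP _ (hd' _ _ sh' th').
move: est est' a b.
move: ('D_w ('D_v f) (s *: v + _)) ('D_v ('D_w f) (s' *: w + _)) => A B.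
move: ('D_w ('D_v f) x) ('D_v ('D_w f) x) => A0 B0 est est' a b.
have AB : A = B.
  apply: (mulIf hn0); apply: (mulIf hn0); rewrite -est -est' (addrCA (h *: w)).
  ring.
rewrite -(subrKA A) {2}AB (le_trans (ler_normD _ _))// (splitr e).
by rewrite [X in _ + X]distrC lerD// ltW.
Qed.

End MixedPartials.

(** * Smooth complex-valued functions *)

Section ComplexCk.
Context {R : realType} {V : normedModType R}.
Local Notation C := R[i].
Implicit Types (f g : V -> C) (U : set V).

(** Conjugation of a numClosedFieldType is specified abstractly; on [R[i]] it is
    the usual one because both satisfy z * conj z = |z|^2. *)
Lemma conjCE (z : C) : z^*%R = complex.Re z -i* complex.Im z.
Proof.
rewrite -[RHS]/(conjc (complex.Re z +i* complex.Im z)).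
have -> : complex.Re z +i* complex.Im z = z by case: z.
have [->|z0] := eqVneq z 0; first by rewrite !rmorph0.
by apply: (mulfI z0); rewrite -normCK sqr_normc.
Qed.

Definition cCinfty U f := Cinfty U (fun x => complex.Re (f x)) /\
                          Cinfty U (fun x => complex.Im (f x)).

Definition cderive v f x : C :=
  'D_v (fun y => complex.Re (f y)) x +i* 'D_v (fun y => complex.Im (f y)) x.

Lemma ReD (a b : C) : complex.Re (a + b) = complex.Re a + complex.Re b.
Proof. by case: a; case: b. Qed.
Lemma ImD (a b : C) : complex.Im (a + b) = complex.Im a + complex.Im b.
Proof. by case: a; case: b. Qed.
Lemma ReM (a b : C) : complex.Re (a * b) =
  complex.Re a * complex.Re b - complex.Im a * complex.Im b.
Proof. by case: a; case: b. Qed.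
Lemma ImM (a b : C) : complex.Im (a * b) =
  complex.Re a * complex.Im b + complex.Im a * complex.Re b.
Proof. by case: a; case: b. Qed.

Lemma cCinfty_open_eq U f g : open U -> {in U, f =1 g} ->
  cCinfty U f -> cCinfty U g.
Proof.
move=> oU fg [r i]; split.
  by apply: Cinfty_open_eq r => // x Ux; rewrite fg.
by apply: Cinfty_open_eq i => // x Ux; rewrite fg.
Qed.

Lemma cCinfty_cst U (a : C) : cCinfty U (cst a).
Proof. by split; exact: Cinfty_cst. Qed.

Lemma cCinftyD U f g : open U -> cCinfty U f -> cCinfty U g ->
  cCinfty U (fun x => f x + g x).
Proof.
move=> oU [fr fi] [gr gi]; split.
  by apply: Cinfty_open_eq (CinftyD oU fr gr) => // x _; rewrite ReD.
by apply: Cinfty_open_eq (CinftyD oU fi gi) => // x _; rewrite ImD.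
Qed.

Lemma cCinftyM U f g : open U -> cCinfty U f -> cCinfty U g ->
  cCinfty U (fun x => f x * g x).
Proof.
move=> oU [fr fi] [gr gi]; split.
  apply: Cinfty_open_eq (CinftyD oU (CinftyM oU fr gr)
    (CinftyN oU (CinftyM oU fi gi))) => // x _; by rewrite ReM.
apply: Cinfty_open_eq (CinftyD oU (CinftyM oU fr gi) (CinftyM oU fi gr)) => //.
by move=> x _; rewrite ImM.
Qed.

Lemma cCinfty_derive U f v : cCinfty U f -> cCinfty U (cderive v f).
Proof. by move=> [fr fi]; split; exact: Cinfty_derive. Qed.

Lemma cderive_open_eq U f g v x : open U -> {in U, f =1 g} -> U x ->
  cderive v f x = cderive v g x.
Proof.
move=> oU fg Ux; rewrite /cderive; congr (_ +i* _);
  by apply: derive_open_eq Ux => // y Uy; rewrite fg.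
Qed.

Lemma cderive_cst (a : C) v x : cderive v (cst a) x = 0.
Proof. by rewrite /cderive !derive_cst. Qed.

Lemma cderiveD U f g v x : cCinfty U f -> cCinfty U g -> U x ->
  cderive v (fun x => f x + g x) x = cderive v f x + cderive v g x.
Proof.
move=> [fr fi] [gr gi] Ux; rewrite /cderive.
rewrite (funext (fun y => ReD (f y) (g y))) (funext (fun y => ImD (f y) (g y))).
rewrite (deriveD (Cinfty_derivable fr Ux) (Cinfty_derivable gr Ux)).
by rewrite (deriveD (Cinfty_derivable fi Ux) (Cinfty_derivable gi Ux)).
Qed.

Lemma cderiveM U f g v x : cCinfty U f -> cCinfty U g -> U x ->
  cderive v (fun x => f x * g x) x = cderive v f x * g x + f x * cderive v g x.
Proof.
move=> [fr fi] [gr gi] Ux; rewrite /cderive.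
have [dfr dfi] := (Cinfty_derivable (v := v) fr Ux, Cinfty_derivable (v := v) fi Ux).
have [dgr dgi] := (Cinfty_derivable (v := v) gr Ux, Cinfty_derivable (v := v) gi Ux).
rewrite (funext (fun y => ReM (f y) (g y))) (funext (fun y => ImM (f y) (g y))).
rewrite (deriveB (derivableM dfr dgr) (derivableM dfi dgi)).
rewrite (deriveD (derivableM dfr dgi) (derivableM dfi dgr)).
have dM (p q : V -> R) : derivable p x v -> derivable q x v ->
    'D_v (p * q) x = p x * 'D_v q x + q x * 'D_v p x by exact: deriveM.
rewrite !dM//.
apply/eqP; rewrite eq_complex !(ReD, ImD, ReM, ImM) /=.
by apply/andP; split; apply/eqP; ring.
Qed.

Lemma cderive_conj U f v x : cCinfty U f -> U x ->
  cderive v (fun x => (f x)^*%R) x = (cderive v f x)^*%R.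
Proof.
move=> [fr fi] Ux; rewrite /cderive [RHS]conjCE /=.
rewrite (funext (fun y => congr1 (@complex.Re R) (conjCE (f y)))).
rewrite (funext (fun y => congr1 (@complex.Im R) (conjCE (f y)))) /=.
by rewrite deriveN//; exact: Cinfty_derivable fi Ux.
Qed.

Lemma cderive_comm U f v w x : open U -> cCinfty U f -> U x ->
  cderive w (cderive v f) x = cderive v (cderive w f) x.
Proof.
move=> oU [fr fi] Ux; rewrite /cderive /=.
by rewrite (derive_comm v w oU (fr 2%N) Ux) (derive_comm v w oU (fi 2%N) Ux).
Qed.

End ComplexCk.

(** * Smooth matrix-valued functions *)

Section MatrixCk.
Context {R : realType} {V : normedModType R}.
Local Notation C := R[i].
Implicit Types (U : set V).

Lemma cCinfty_sum (I : Type) (r : seq I) (f : I -> V -> C) U : open U ->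
  (forall i, cCinfty U (f i)) -> cCinfty U (fun x => \sum_(i <- r) f i x).
Proof.
move=> oU fU; elim: r => [|i r IH].
  by apply: cCinfty_open_eq (cCinfty_cst U 0) => // x _; rewrite big_nil.
by apply: cCinfty_open_eq (cCinftyD oU (fU i) IH) => // x _; rewrite big_cons.
Qed.

Lemma cderive_sum (I : Type) (r : seq I) (f : I -> V -> C) U v x : open U ->
  (forall i, cCinfty U (f i)) -> U x ->
  cderive v (fun x => \sum_(i <- r) f i x) x = \sum_(i <- r) cderive v (f i) x.
Proof.
move=> oU fU Ux; elim: r => [|i r IH].
  rewrite big_nil (_ : (fun x => _) = cst 0) ?cderive_cst//.
  by apply/funext => y; rewrite big_nil.
rewrite big_cons -IH -(cderiveD _ (fU i) (cCinfty_sum r oU fU) Ux).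
by congr (cderive v _ x); apply/funext => y; rewrite big_cons.
Qed.

Lemma mx_deriveE m n v (F : V -> 'M[C]_(m, n)) x a b :
  mx_derive v F x a b = cderive v (fun y => F y a b) x.
Proof. by rewrite mxE. Qed.

Lemma mx_Cinfty_open_eq m n U (F G : V -> 'M[C]_(m, n)) : open U ->
  {in U, F =1 G} -> mx_Cinfty U F -> mx_Cinfty U G.
Proof.
by move=> oU FG UF a b; apply: cCinfty_open_eq (UF a b) => // x Ux; rewrite FG.
Qed.

Lemma mx_derive_open_eq m n U (F G : V -> 'M[C]_(m, n)) v x : open U ->
  {in U, F =1 G} -> U x -> mx_derive v F x = mx_derive v G x.
Proof.
move=> oU FG Ux; apply/matrixP => a b; rewrite !mx_deriveE.
by apply: cderive_open_eq Ux => // y Uy; rewrite FG.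
Qed.

Lemma mx_Cinfty_cst m n U (A : 'M[C]_(m, n)) : mx_Cinfty U (cst A).
Proof. by move=> a b; exact: cCinfty_cst. Qed.

Lemma mx_derive_cst m n (A : 'M[C]_(m, n)) (v x : V) :
  mx_derive v (cst A) x = 0.
Proof. by apply/matrixP => a b; rewrite mx_deriveE cderive_cst mxE. Qed.

Lemma mx_CinftyD m n U (F G : V -> 'M[C]_(m, n)) : open U ->
  mx_Cinfty U F -> mx_Cinfty U G -> mx_Cinfty U (fun x => F x + G x).
Proof.
move=> oU UF UG a b; apply: cCinfty_open_eq (cCinftyD oU (UF a b) (UG a b)) => //.
by move=> x _; rewrite mxE.
Qed.

Lemma mx_deriveD m n U (F G : V -> 'M[C]_(m, n)) v x :
  mx_Cinfty U F -> mx_Cinfty U G -> U x ->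
  mx_derive v (fun x => F x + G x) x = mx_derive v F x + mx_derive v G x.
Proof.
move=> UF UG Ux; apply/matrixP => a b; rewrite [RHS]mxE !mx_deriveE.
rewrite -(cderiveD _ (UF a b) (UG a b) Ux).
by congr (cderive v _ x); apply/funext => y; rewrite mxE.
Qed.

Lemma mx_CinftyM m n p U (F : V -> 'M[C]_(m, n)) (G : V -> 'M[C]_(n, p)) :
  open U -> mx_Cinfty U F -> mx_Cinfty U G -> mx_Cinfty U (fun x => F x *m G x).
Proof.
move=> oU UF UG a b.
apply: cCinfty_open_eq (cCinfty_sum (index_enum 'I_n) oU
  (fun j => cCinftyM oU (UF a j) (UG j b))) => // x _.
by rewrite mxE.
Qed.

Lemma mx_deriveM m n p U (F : V -> 'M[C]_(m, n)) (G : V -> 'M[C]_(n, p)) v x :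
  open U -> mx_Cinfty U F -> mx_Cinfty U G -> U x ->
  mx_derive v (fun x => F x *m G x) x =
  mx_derive v F x *m G x + F x *m mx_derive v G x.
Proof.
move=> oU UF UG Ux; apply/matrixP => a b; rewrite [RHS]mxE mx_deriveE.
rewrite [X in X + _]mxE [X in _ + X]mxE -big_split /=.
under eq_bigr do rewrite !mx_deriveE -(cderiveM _ (UF _ _) (UG _ _) Ux).
rewrite -(cderive_sum _ _ oU (fun j => cCinftyM oU (UF a j) (UG j b)) Ux).
by congr (cderive v _ x); apply/funext => y; rewrite mxE.
Qed.

Lemma mx_CinftyZ m n U (c : C) (F : V -> 'M[C]_(m, n)) : open U ->
  mx_Cinfty U F -> mx_Cinfty U (fun x => c *: F x).
Proof.
move=> oU UF; apply: mx_Cinfty_open_eq (mx_CinftyM oU (mx_Cinfty_cst U c%:M) UF) => //.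
by move=> x _; rewrite mul_scalar_mx.
Qed.

Lemma mx_deriveZ m n U (c : C) (F : V -> 'M[C]_(m, n)) v x : open U ->
  mx_Cinfty U F -> U x ->
  mx_derive v (fun x => c *: F x) x = c *: mx_derive v F x.
Proof.
move=> oU UF Ux; have := mx_deriveM v oU (mx_Cinfty_cst U c%:M) UF Ux.
rewrite mx_derive_cst mul0mx add0r mul_scalar_mx => <-; congr (mx_derive v _ x).
by apply/funext => y; rewrite mul_scalar_mx.
Qed.

Lemma mx_derive_adj m n U (F : V -> 'M[C]_(m, n)) v x : mx_Cinfty U F -> U x ->
  mx_derive v (fun x => (F x ^t*)%sesqui) x = (mx_derive v F x ^t*)%sesqui.
Proof.
move=> UF Ux; apply/matrixP => a b.
rewrite mx_deriveE 2!mxE mx_deriveE -(cderive_conj _ (UF b a) Ux).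
by congr (cderive v _ x); apply/funext => y; rewrite !mxE.
Qed.

Lemma mx_Cinfty_derive m n U (F : V -> 'M[C]_(m, n)) v :
  mx_Cinfty U F -> mx_Cinfty U (mx_derive v F).
Proof.
move=> UF a b; have := cCinfty_derive v (UF a b).
by congr cCinfty; apply/funext => x; rewrite mx_deriveE.
Qed.

Lemma mx_derive_comm m n U (F : V -> 'M[C]_(m, n)) v w x : open U ->
  mx_Cinfty U F -> U x ->
  mx_derive w (mx_derive v F) x = mx_derive v (mx_derive w F) x.
Proof.
move=> oU UF Ux; apply/matrixP => a b.
have e u : (fun y => mx_derive u F y a b) = cderive u (fun y => F y a b).
  by apply/funext => y; rewrite mx_deriveE.
rewrite [LHS]mx_deriveE [RHS]mx_deriveE (e v) (e w).
exact: cderive_comm oU (UF a b) Ux.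
Qed.

Lemma mx_Cinfty_sum m n (I : Type) (r : seq I) (F : I -> V -> 'M[C]_(m, n)) U :
  open U -> (forall i, mx_Cinfty U (F i)) ->
  mx_Cinfty U (fun x => \sum_(i <- r) F i x).
Proof.
move=> oU UF; elim: r => [|i r IH].
  by apply: mx_Cinfty_open_eq (mx_Cinfty_cst U 0) => // x _; rewrite big_nil.
by apply: mx_Cinfty_open_eq (mx_CinftyD oU (UF i) IH) => // x _; rewrite big_cons.
Qed.

End MatrixCk.

(** * The operators d/dz and d/dzbar *)

Section Del.
Context {R : realType}.
Local Notation C := R[i].
Implicit Types (U : set (R * R)).

(** Both [Dz] and [Dzbar] are of this form, with [u = -'i] and [u = 'i]; the
    common rules of calculus are proved once for all [u]. *)
Definition del {m n : nat} (u : C) (F : R * R -> 'M[C]_(m, n)) (x : R * R) :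
    'M[C]_(m, n) :=
  2^-1 *: (mx_derive (1 : R, 0 : R) F x + u *: mx_derive (0 : R, 1 : R) F x).

Lemma DzE m n : @Dz R m n = del (- 'i%C).
Proof. by apply/funext => F; apply/funext => x; rewrite /Dz /del scaleNr. Qed.

Lemma DzbarE m n : @Dzbar R m n = del 'i%C.
Proof. by []. Qed.

Section Rules.
Variables (U : set (R * R)) (oU : open U).

Lemma del_open_eq m n u (F G : R * R -> 'M[C]_(m, n)) x :
  {in U, F =1 G} -> U x -> del u F x = del u G x.
Proof. by move=> FG Ux; rewrite /del !(mx_derive_open_eq _ oU FG Ux). Qed.

Lemma del_cst m n u (A : 'M[C]_(m, n)) x : del u (cst A) x = 0.
Proof. by rewrite /del !mx_derive_cst scaler0 addr0 scaler0. Qed.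

Lemma delD m n u (F G : R * R -> 'M[C]_(m, n)) x :
  mx_Cinfty U F -> mx_Cinfty U G -> U x ->
  del u (fun x => F x + G x) x = del u F x + del u G x.
Proof.
move=> UF UG Ux; rewrite /del !(mx_deriveD _ UF UG Ux) -scalerDr.
by rewrite (scalerDr u) addrACA.
Qed.

Lemma delZ m n u (c : C) (F : R * R -> 'M[C]_(m, n)) x :
  mx_Cinfty U F -> U x -> del u (fun x => c *: F x) x = c *: del u F x.
Proof.
move=> UF Ux; rewrite /del !(mx_deriveZ _ _ oU UF Ux).
move: (2^-1) (mx_derive _ F x) (mx_derive _ F x) => h A B.
rewrite (scalerDr h) (scalerDr h) (scalerDr c) !scalerA.
by congr (_ *: _ + _ *: _); ring.
Qed.

Lemma delM m n p u (F : R * R -> 'M[C]_(m, n)) (G : R * R -> 'M[C]_(n, p)) x :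
  mx_Cinfty U F -> mx_Cinfty U G -> U x ->
  del u (fun x => F x *m G x) x = del u F x *m G x + F x *m del u G x.
Proof.
move=> UF UG Ux; rewrite /del !(mx_deriveM _ oU UF UG Ux).
rewrite -!(scalemxAl, scalemxAr) mulmxDl mulmxDr -!(scalemxAl, scalemxAr).
by rewrite -scalerDr (scalerDr u) addrACA.
Qed.

Lemma del_sum m n u (I : Type) (r : seq I) (F : I -> R * R -> 'M[C]_(m, n)) x :
  (forall i, mx_Cinfty U (F i)) -> U x ->
  del u (fun x => \sum_(i <- r) F i x) x = \sum_(i <- r) del u (F i) x.
Proof.
move=> UF Ux; elim: r => [|i r IH].
  rewrite big_nil -[RHS](del_cst u (0 : 'M[C]_(m, n)) x).
  by congr (del u _ x); apply/funext => y; rewrite big_nil.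
rewrite big_cons -IH -(delD _ (UF i) (mx_Cinfty_sum r oU UF) Ux).
by congr (del u _ x); apply/funext => y; rewrite big_cons.
Qed.

Lemma mx_Cinfty_del m n u (F : R * R -> 'M[C]_(m, n)) :
  mx_Cinfty U F -> mx_Cinfty U (del u F).
Proof.
move=> UF; apply/mx_CinftyZ/mx_CinftyD => //; first exact: mx_Cinfty_derive.
by apply/mx_CinftyZ => //; exact: mx_Cinfty_derive.
Qed.

Lemma del_adj m n u (F : R * R -> 'M[C]_(m, n)) x : mx_Cinfty U F -> U x ->
  (del u F x ^t*)%sesqui = del u^*%R (fun x => (F x ^t*)%sesqui) x.
Proof.
move=> UF Ux; rewrite /del !(mx_derive_adj _ UF Ux) [in LHS]linearZ.
rewrite [in LHS]linearD [in LHS]linearZ /=.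
by rewrite !(map_mxZ, map_mxD) fmorphV rmorph_nat.
Qed.

Lemma del_comm m n u w (F : R * R -> 'M[C]_(m, n)) x : mx_Cinfty U F -> U x ->
  del u (del w F) x = del w (del u F) x.
Proof.
move=> UF Ux; pose e1 : R * R := (1, 0); pose e2 : R * R := (0, 1).
have UD v : mx_Cinfty U (mx_derive v F) by exact: mx_Cinfty_derive.
have E v c : mx_derive v (del c F) x =
    2^-1 *: (mx_derive v (mx_derive e1 F) x + c *: mx_derive v (mx_derive e2 F) x).
  rewrite (mx_deriveZ _ _ oU (mx_CinftyD oU (UD e1) (mx_CinftyZ c oU (UD e2))) Ux).
  rewrite (mx_deriveD _ (UD e1) (mx_CinftyZ c oU (UD e2)) Ux).
  by rewrite (mx_deriveZ _ _ oU (UD e2) Ux).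
rewrite {1}/del !E {1}/del !E (mx_derive_comm e1 e2 oU UF Ux).
move: (2^-1) (mx_derive e1 (mx_derive e1 F) x) (mx_derive e2 (mx_derive e2 F) x).
move: (mx_derive e2 (mx_derive e1 F) x) => K h A B.
rewrite !(scalerDr, scalerA) -!addrA; congr (_ + _).
by rewrite addrCA; congr (_ + (_ + _)); congr (_ *: _); ring.
Qed.

End Rules.
End Del.

(** * Noncommutative identities behind a Gauss step *)

Section ProjectionAlgebra.
Context {A : pzRingType}.
Implicit Types p q a b h r : A.

(** In this section [p] and [q] are the values at a point of the projections onto
    a bundle and onto its Gauss bundle, [a] and [a'] (resp. [b] and [b']) their
    derivatives by z (resp. zbar), and [h] and [h'] their mixed second
    derivatives.  The hypotheses are the Leibniz rule for identities between the
    projections. *)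

(** The derivative of an idempotent maps its range into its kernel. *)
Lemma deriv_idem_sandwich p a : p * p = p -> a = a * p + p * a -> p * a * p = 0.
Proof.
move=> pp aE; have : p * a * p = p * a * p + p * a * p.
  by rewrite {1}aE mulrDr mulrDl !mulrA pp -!(mulrA _ p p) pp.
by move/eqP; rewrite -subr_eq0 opprD addrA subrr add0r oppr_eq0 => /eqP.
Qed.

(** [a * p = (1 - p) * a] is the second fundamental form, which takes its values
    in the range of [q]. *)
Lemma gauss_step_dz p q a : a = a * p + p * a -> q * (a * p) = a * p ->
  q * p = 0 -> a = (p + q) * a.
Proof.
move=> aE qap qp.
by rewrite mulrDl [in q * a]aE mulrDr qap mulrA qp mul0r addr0 addrC.
Qed.

(** Derivatives by zbar of the sections [a * p] of the Gauss bundle stay in the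
    sum of the bundle and its Gauss bundle; [r] is the projection onto the
    complement of that sum.  Harmonicity enters as [h * p = p * h], which makes
    the second derivative [h * p] take its values in the bundle. *)
Lemma gauss_step_vanish p q a b b' h r :
  r * p = 0 -> r * q = 0 -> a = (p + q) * a -> h * p = p * h ->
  b' * (a * p) + q * (h * p + a * b) = h * p + a * b -> r * (b' * (a * p)) = 0.
Proof.
move=> rp rq aE hp e; have ra : r * a = 0 by rewrite aE mulrA mulrDr rp rq addr0 mul0r.
have -> : b' * (a * p) = h * p + a * b - q * (h * p + a * b) by rewrite -{1}e addrK.
by rewrite mulrBr mulrDr hp !mulrA rp rq ra !mul0r addr0 subr0.
Qed.

(** The identity [b' * q = - (p * b)] says that the (0,1) second fundamental form
    of the Gauss bundle is minus the adjoint of the (1,0) form of the bundle.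
    Its derivative by z expresses [h' * q] through the original bundle, and after
    multiplication by [1 - q] on the left and [q] on the right each term
    contains a derivative of an idempotent sandwiched between two copies of it,
    or [p * q]. *)
Lemma gauss_step_harmonic p q a b a' b' h h' :
  p * p = p -> p * q = 0 ->  q * p = 0 -> q * q = q ->
  a = a * p + p * a -> b = b * p + p * b ->
  a' = a' * q + q * a' -> b' = b' * q + q * b' ->
  q * (a * p) = a * p -> p * b * q = p * b -> h * p = p * h ->
  b' * q = - (p * b) -> h' * q + b' * a' = - (a * b + p * h) ->
  h' * q = q * h' * q.
Proof.
move=> pp pq qp qq aE bE a'E b'E qap pbq hp b'q hE.
set r := 1 - q; have rE c : r * c = c - q * c by rewrite mulrBl mul1r.
have rp : r * p = p by rewrite rE qp subr0.
have ra : r * a = p * a by rewrite rE [q * a](_ : _ = a * p) {1}aE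
  ?mulrDr ?qap ?mulrA ?qp ?mul0r ?addr0// addrC addKr.
have rb' : r * b' = - (p * b) by rewrite rE {1}b'E addrK.
have bq : b * q = p * b by rewrite {1}bE mulrDl -mulrA pq mulr0 add0r pbq.
have h'qE : h' * q = - (a * b + p * h) - b' * a' by rewrite -hE addrK.
have : r * (h' * q) = p * b * a' - p * a * b - p * h.
  rewrite h'qE mulrBr mulrN mulrDr !mulrA rb' ra rp mulNr opprK addrC.
  by rewrite opprD addrA.
move/(congr1 (fun c => c * q)); rewrite -(mulrA r) -(mulrA h') qq.
rewrite !mulrBl -[p * h]hp -(mulrA h) pq mulr0 subr0.
rewrite -pbq -(mulrA (p * b)) -(mulrA (p * b)) (mulrA q).
rewrite (deriv_idem_sandwich qq a'E) mulr0 sub0r.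
rewrite -(mulrA (p * a)) bq (mulrA (p * a)) (deriv_idem_sandwich pp aE) mul0r oppr0.
by rewrite mul1r => /eqP; rewrite subr_eq0 => /eqP.
Qed.

End ProjectionAlgebra.

(** * Gauss steps of projections on a plane domain *)

Section LocalProjections.
Context {R : realType} {n : nat} (U : set (R * R)) (oU : open U).
Local Notation C := R[i].
Local Notation field := (R * R -> 'M[C]_n).
Local Notation dd := (@del R n n (- 'i%C)).
Local Notation db := (@del R n n 'i%C).
Local Notation adj A := (A ^t*)%sesqui.
Implicit Types (P Q F G : field) (u : C).

(** A point of the plane is not isolated.  Approaching [x] along a horizontal line
    suffices to compare the two continuous functions. *)
Lemma eq_of_near_punctured F G x : mx_Cinfty U F -> mx_Cinfty U G -> U x ->
  (\forall y \near x^', F y = G y) -> F x = G x.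
Proof.
move=> UF UG Ux FG.
pose l (h : R) : R * R := (h, 0) + x.
have l0 : l 0 = x by rewrite /l [(0, 0)](_ : _ = 0) ?add0r.
have cl : l h @[h --> (0 : R)^'] --> x.
  apply: cvg_within_filter.
  have : {for (0 : R), continuous l}.
    apply: (@continuousD _ _ _ (fun h : R => (h, 0) : R * R) (cst x)).
      rewrite /prop_for /continuous_at.
      by apply: (@cvg_pair _ _ _ _ (nbhs (0 : R)) (nbhs (0 : R)) _ _ _ id (cst 0));
        [exact: cvg_id|exact: cvg_cst].
    exact: cvg_cst.
  by rewrite /prop_for /continuous_at l0.
have FGl : \forall h \near (0 : R)^', F (l h) = G (l h).
  have nFG : \forall h \near (0 : R)^', l h != x -> F (l h) = G (l h) by exact: cl _ FG.
  have n0 : \forall h \near (0 : R)^', h != 0 by exact: nbhs_dnbhs_neq.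
  apply: filterS2 nFG n0 => h FGh h0; apply: FGh.
  by rewrite /l -subr_eq0 addrK; apply: contra h0 => /eqP[->].
have eq_real (f g : R * R -> R) : {for x, continuous f} -> {for x, continuous g} ->
    (\forall h \near (0 : R)^', f (l h) = g (l h)) -> f x = g x.
  move=> cf cg fg.
  have lf : f (l h) @[h --> (0 : R)^'] --> f x by exact: cvg_comp cl cf.
  have lg : g (l h) @[h --> (0 : R)^'] --> g x by exact: cvg_comp cl cg.
  apply: (@cvg_unique _ (@norm_hausdorff _ R) _ _ _ _ lf).
  apply: cvg_trans lg; apply: near_eq_cvg.
  by apply: filterS fg => h ->.
apply/matrixP => a b; apply/eqP; rewrite eq_complex; apply/andP; split; apply/eqP.
  apply: (eq_real (fun y => complex.Re (F y a b)) (fun y => complex.Re (G y a b))).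
  - exact: Cinfty_continuous (UF a b).1 Ux.
  - exact: Cinfty_continuous (UG a b).1 Ux.
  - by apply: filterS FGl => h ->.
apply: (eq_real (fun y => complex.Im (F y a b)) (fun y => complex.Im (G y a b))).
- exact: Cinfty_continuous (UF a b).2 Ux.
- exact: Cinfty_continuous (UG a b).2 Ux.
- by apply: filterS FGl => h ->.
Qed.

Lemma adjM (F G : 'M[C]_n) : adj (F * G) = adj G * adj F.
Proof. by rewrite -!mulmxE trmx_mul map_mxM. Qed.

Lemma adjD (F G : 'M[C]_n) : adj (F + G) = adj F + adj G.
Proof. by rewrite linearD map_mxD. Qed.

Lemma adj0 : adj (0 : 'M[C]_n) = 0.
Proof. by rewrite trmx0 map_mx0. Qed.

Lemma del_mul u F G x : mx_Cinfty U F -> mx_Cinfty U G -> U x ->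
  del u (fun x => F x * G x) x = del u F x * G x + F x * del u G x.
Proof. exact: delM. Qed.

Lemma mx_Cinfty_mul F G : mx_Cinfty U F -> mx_Cinfty U G ->
  mx_Cinfty U (fun x => F x * G x).
Proof. exact: mx_CinftyM. Qed.

Lemma mx_CinftyN F : mx_Cinfty U F -> mx_Cinfty U (fun x => - F x).
Proof.
move=> UF; apply: mx_Cinfty_open_eq (mx_CinftyZ (-1) oU UF) => // x _.
by rewrite scaleN1r.
Qed.

Lemma mx_CinftyB F G : mx_Cinfty U F -> mx_Cinfty U G ->
  mx_Cinfty U (fun x => F x - G x).
Proof. by move=> UF UG; apply: mx_CinftyD => //; exact: mx_CinftyN. Qed.

Definition projection_field P := mx_Cinfty U P /\
  forall x, U x -> adj (P x) = P x /\ P x * P x = P x.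

(** The harmonic map equation for the involution [2 P - 1]. *)
Definition harmonic_field P :=
  forall x, U x -> dd (db P) x * P x = P x * dd (db P) x.

(** Near every point, with the point itself excepted, the range of [Q] is that of
    [(d P) P], which is the image of the second fundamental form. *)
Definition gauss_step P Q := forall x, U x -> \forall y \near x^',
  Q y * (dd P y * P y) = dd P y * P y /\ exists X, Q y = dd P y * P y * X.

Lemma del_idem u P x : projection_field P -> U x ->
  del u P x = del u P x * P x + P x * del u P x.
Proof.
move=> [UP PP] Ux; rewrite -(del_mul _ UP UP Ux).
by apply: del_open_eq Ux => // y; rewrite inE => /PP[].
Qed.

Lemma del_orth u P Q x : mx_Cinfty U P -> mx_Cinfty U Q ->
  (forall x, U x -> P x * Q x = 0) -> U x ->
  del u P x * Q x = - (P x * del u Q x).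
Proof.
move=> UP UQ PQ Ux; apply/eqP; rewrite -addr_eq0 -(del_mul _ UP UQ Ux); apply/eqP.
rewrite -[RHS](del_cst u 0 x).
by apply: del_open_eq Ux => // y; rewrite inE => /PQ.
Qed.

Lemma conj_i : ('i%C : C)^*%R = - 'i%C.
Proof. by rewrite conjCE /= -[RHS]/(- 0 +i* - 1) oppr0. Qed.

Lemma adj_dz P x : projection_field P -> U x -> adj (dd P x) = db P x.
Proof.
move=> [UP PP] Ux; rewrite (del_adj _ UP Ux) rmorphN /= conj_i opprK.
by apply: del_open_eq Ux => // y; rewrite inE => /PP[].
Qed.

Lemma adj_dzbar P x : projection_field P -> U x -> adj (db P x) = dd P x.
Proof. by move=> pP Ux; rewrite -adj_dz// trmxCK. Qed.

Lemma adj_laplacian P x : projection_field P -> U x ->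
  adj (dd (db P) x) = dd (db P) x.
Proof.
move=> pP Ux; have [UP _] := pP.
rewrite (del_adj _ (mx_Cinfty_del oU _ UP) Ux) rmorphN /= conj_i opprK.
rewrite (del_comm oU _ _ UP Ux).
by apply: del_open_eq Ux => // y; rewrite inE => Uy; exact: adj_dzbar.
Qed.

Lemma near_punctured_open x : U x -> \forall y \near x^', U y.
Proof. by move=> Ux; apply: nbhs_dnbhs; exact: open_nbhs_nbhs. Qed.

Section GaussStep.
Variables (P Q : field) (pP : projection_field P) (pQ : projection_field Q).
Hypothesis PQ : gauss_step P Q.

Let UP : mx_Cinfty U P. Proof. by case: pP. Qed.
Let UQ : mx_Cinfty U Q. Proof. by case: pQ. Qed.
Let PP x : U x -> P x * P x = P x. Proof. by case: pP => _ H /H[]. Qed.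
Let QQ x : U x -> Q x * Q x = Q x. Proof. by case: pQ => _ H /H[]. Qed.
Let PH x : U x -> adj (P x) = P x. Proof. by case: pP => _ H /H[]. Qed.
Let QH x : U x -> adj (Q x) = Q x. Proof. by case: pQ => _ H /H[]. Qed.
Let UdP u : mx_Cinfty U (del u P). Proof. exact: mx_Cinfty_del. Qed.
Let UdQ u : mx_Cinfty U (del u Q). Proof. exact: mx_Cinfty_del. Qed.
Let UdPP : mx_Cinfty U (fun x => dd P x * P x). Proof. exact: mx_Cinfty_mul. Qed.

(** The inclusion of the image in the range of [Q] is a closed condition, and
    therefore survives at the exceptional points. *)
Lemma gauss_image x : U x -> Q x * (dd P x * P x) = dd P x * P x.
Proof.
move=> Ux; apply: (eq_of_near_punctured (F := fun x => Q x * (dd P x * P x))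
  (G := fun x => dd P x * P x) (mx_Cinfty_mul UQ UdPP) UdPP Ux).
by apply: filterS (PQ Ux) => y [].
Qed.

Lemma gauss_orthl x : U x -> P x * Q x = 0.
Proof.
move=> Ux; apply: (eq_of_near_punctured (F := fun x => P x * Q x)
  (G := cst 0) (mx_Cinfty_mul UP UQ) (mx_Cinfty_cst U 0) Ux).
apply: filterS2 (PQ Ux) (near_punctured_open Ux) => y [_ [X ->]] Uy.
by rewrite !mulrA (deriv_idem_sandwich (PP Uy) (del_idem _ pP Uy)) mul0r.
Qed.

Lemma gauss_orthr x : U x -> Q x * P x = 0.
Proof.
by move=> Ux; rewrite -(QH Ux) -(PH Ux) -adjM (gauss_orthl Ux) adj0.
Qed.

Lemma gauss_dz x : U x -> dd P x = (P x + Q x) * dd P x.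
Proof.
move=> Ux; apply: gauss_step_dz (del_idem _ pP Ux) (gauss_image Ux) _.
exact: gauss_orthr.
Qed.

Hypothesis hP : harmonic_field P.

(** On the generic set the range of [Q] is spanned by the values of [(d P) P],
    whose derivatives by zbar are controlled by harmonicity of [P]. *)
Lemma gauss_dzbar x : U x -> db Q x = (P x + Q x) * db Q x.
Proof.
move=> Ux; pose r y := 1 - P y - Q y.
have Ur : mx_Cinfty U r.
  by apply: mx_CinftyB => //; apply: mx_CinftyB => //; exact: mx_Cinfty_cst.
have rP y : U y -> r y * P y = 0.
  by move=> Uy; rewrite /r !mulrBl mul1r PP// gauss_orthr// subrr subr0.
have rQ y : U y -> r y * Q y = 0.
  by move=> Uy; rewrite /r !mulrBl mul1r QQ// gauss_orthl// subr0 subrr.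
have vanish : r x * (db Q x * Q x) = 0.
  apply: (eq_of_near_punctured (F := fun x => r x * (db Q x * Q x))
    (G := cst 0) _ _ Ux) => //; last 1 first.
  - apply: filterS2 (PQ Ux) (near_punctured_open Ux) => y [_ [X QE]] Uy.
    rewrite QE (mulrA (db Q y)) (mulrA (r y)).
    rewrite [Z in Z * X](_ : _ = 0) ?mul0r//.
    apply: (gauss_step_vanish (b := db P y) (h := dd (db P) y) (rP y Uy) (rQ y Uy)
      (gauss_dz Uy) (hP Uy)).
    have dE : db (fun z => dd P z * P z) y = dd (db P) y * P y + dd P y * db P y.
      by rewrite (del_mul _ (UdP _) UP Uy) (del_comm oU _ _ UP Uy).
    rewrite -dE -(del_mul 'i%C UQ UdPP Uy).
    by apply: del_open_eq Uy => // z; rewrite inE => Uz; exact: gauss_image.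
  - exact: (mx_Cinfty_mul Ur (mx_Cinfty_mul (UdQ _) UQ)).
  - exact: mx_Cinfty_cst.
have : r x * db Q x = 0.
  by rewrite (del_idem _ pQ Ux) mulrDr vanish mulrA rQ// mul0r addr0.
by rewrite /r -addrA -opprD mulrBl mul1r => /eqP; rewrite subr_eq0 => /eqP.
Qed.

Lemma gauss_harmonic : harmonic_field Q.
Proof.
have pbq y : U y -> P y * db P y * Q y = P y * db P y.
  move=> Uy; have := congr1 (fun A => adj A) (gauss_image Uy).
  by rewrite !adjM QH// PH// adj_dz.
have bq y : U y -> db P y * Q y = P y * db P y.
  move=> Uy; rewrite -[RHS]pbq// {1}(del_idem _ pP Uy) mulrDl -mulrA.
  by rewrite gauss_orthl// mulr0 add0r.
have b'q y : U y -> db Q y * Q y = - (P y * db P y).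
  move=> Uy; have : db Q y - Q y * db Q y = P y * db Q y.
    by rewrite {1}gauss_dzbar// mulrDl addrK.
  rewrite {1}(del_idem _ pQ Uy) addrK => ->; rewrite -bq//.
  by rewrite (del_orth _ UP UQ gauss_orthl Uy) opprK.
move=> x Ux.
have hqE : dd (db Q) x * Q x + db Q x * dd Q x =
    - (dd P x * db P x + P x * dd (db P) x).
  rewrite -(del_mul _ (UdQ _) UQ Ux) -(del_mul _ UP (UdP _) Ux) -[RHS]scaleN1r.
  rewrite -(delZ oU _ _ (mx_Cinfty_mul UP (UdP _)) Ux).
  by apply: del_open_eq Ux => // y; rewrite inE => Uy; rewrite b'q// scaleN1r.
have hq := gauss_step_harmonic (PP Ux) (gauss_orthl Ux) (gauss_orthr Ux) (QQ Ux)
  (del_idem _ pP Ux) (del_idem _ pP Ux) (del_idem _ pQ Ux) (del_idem _ pQ Ux)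
  (gauss_image Ux) (pbq x Ux) (hP Ux) (b'q x Ux) hqE.
have := congr1 (fun A => adj A) hq.
by rewrite !adjM QH// adj_laplacian// mulrA -hq => ->.
Qed.

End GaussStep.

End LocalProjections.

(** * Orthogonality and differentiation in a Gauss sequence *)

Section GaussSequence.
Context {R : realType} {n : nat} (U : set (R * R)) (oU : open U).
Local Notation C := R[i].
Local Notation dd := (@del R n n (- 'i%C)).
Local Notation db := (@del R n n 'i%C).
Local Notation adj A := (A ^t*)%sesqui.
Variable G : nat -> R * R -> 'M[C]_n.
Hypothesis pG : forall i, projection_field U (G i).
Hypothesis stepG : forall i, gauss_step U (G i) (G i.+1).
Hypothesis harm0 : harmonic_field U (G 0%N).
Hypothesis orth0 : forall j x, (0 < j)%N -> U x -> G 0%N x * G j x = 0.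

Let UG i : mx_Cinfty U (G i). Proof. by case: (pG i). Qed.
Let GG i x : U x -> G i x * G i x = G i x.
Proof. by case: (pG i) => _ H /H[]. Qed.
Let GH i x : U x -> adj (G i x) = G i x.
Proof. by case: (pG i) => _ H /H[]. Qed.

Lemma gauss_sequence_harmonic i : harmonic_field U (G i).
Proof.
elim: i => [|i hi]; first exact: harm0.
exact: (gauss_harmonic oU (pG i) (pG i.+1) (stepG i) hi).
Qed.

Let dzG i x : U x -> dd (G i) x = (G i x + G i.+1 x) * dd (G i) x.
Proof. exact: (gauss_dz oU (pG i) (pG i.+1) (stepG i)). Qed.

Let dzbarG i x : U x -> db (G i.+1) x = (G i x + G i.+1 x) * db (G i.+1) x.
Proof.
exact: (gauss_dzbar oU (pG i) (pG i.+1) (stepG i) (gauss_sequence_harmonic i)).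
Qed.

(** If [G i] is orthogonal to all later bundles, then so is [G (i + 1)]:
    [G i * d' (G j) = 0] for [j > i + 1] because [d' (G j)] takes its values in
    [G (j - 1) + G j]; taking adjoints and using [G j * G i = 0], also
    [G j * d (G i) * G i = 0], and the range of [d (G i) * G i] is generically
    that of [G (i + 1)]. *)
Lemma gauss_sequence_orth_lt i j x : (i < j)%N -> U x -> G i x * G j x = 0.
Proof.
elim: i j x => [|i IH] j x; first exact: orth0.
case: j => // j; rewrite ltnS => ij Ux.
have IHl k y : (i < k)%N -> U y -> G k y * G i y = 0.
  by move=> ik Uy; rewrite -(GH k Uy) -(GH i Uy) -adjM IH// adj0.
have ij' : (i < j.+1)%N by exact: ltnW.
have vanish y : U y -> dd (G j.+1) y * G i y = 0.
  move=> Uy; rewrite -(GH i Uy) -(adj_dzbar oU (pG j.+1) Uy) -adjM.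
  by rewrite dzbarG// mulrA mulrDr !IH// addr0 mul0r adj0.
suff e : G j.+1 x * G i.+1 x = 0.
  by rewrite -(GH j.+1 Ux) -(GH i.+1 Ux) -adjM e adj0.
apply: (eq_of_near_punctured (mx_Cinfty_mul oU (UG j.+1) (UG i.+1))
  (mx_Cinfty_cst U 0) Ux).
have nU := near_punctured_open oU Ux.
apply: filterS2 (stepG i Ux) nU => y [_ [X ->]] Uy.
rewrite mulrA (mulrA (G j.+1 y)).
have := del_orth oU (- 'i%C) (UG j.+1) (UG i) (fun y => IHl _ y ij') Uy.
by rewrite vanish// => /eqP; rewrite eq_sym oppr_eq0 => /eqP ->; rewrite !mul0r.
Qed.

Lemma gauss_sequence_orth i j x : i != j -> U x -> G i x * G j x = 0.
Proof.
rewrite neq_ltn => /orP[ij|ji] Ux; first exact: gauss_sequence_orth_lt.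
by rewrite -(GH i Ux) -(GH j Ux) -adjM gauss_sequence_orth_lt// adj0.
Qed.

Variables (m : nat) (Gm0 : forall x, U x -> G m.+1 x = 0).

(** The projection onto delta.  The sum starts at 1 and stops at the last index
    before a vanishing bundle, so that it is closed under [i |-> i + 1]. *)
Definition gauss_sum x := \sum_(i <- iota 1 m) G i x.
Local Notation D := gauss_sum.

Lemma gauss_sum_Cinfty : mx_Cinfty U D.
Proof. exact: mx_Cinfty_sum. Qed.

(** The value [k = m + 1] is included so that the lemma applies to both bundles
    occurring in [d (G m)]; there both sides vanish. *)
Lemma gauss_sum_mul k x : (0 < k <= m.+1)%N -> U x -> D x * G k x = G k x.
Proof.
move=> /andP[k0 km] Ux; have [km1|/eqP km1] := eqVneq k m.+1.
  by rewrite km1 Gm0// mulr0.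
rewrite /D mulr_suml (big_rem k)/=; last first.
  by rewrite mem_iota k0 add1n ltnS -ltnS ltn_neqAle km andbT; apply/eqP.
rewrite GG// big_seq big1 ?addr0// => i.
rewrite mem_rem_uniq ?iota_uniq// inE => /andP[ik _].
exact: gauss_sequence_orth.
Qed.

Lemma gauss_sum_mul0 x : U x -> D x * G 0%N x = 0.
Proof.
move=> Ux; rewrite /D mulr_suml big_seq big1// => i.
rewrite mem_iota => /andP[i0 _]; apply: gauss_sequence_orth => //.
by rewrite -lt0n.
Qed.

Lemma gauss_sum_projection : projection_field U D.
Proof.
split=> [|x Ux]; first exact: gauss_sum_Cinfty.
split.
  rewrite /D linear_sum /= map_mx_sum /=.
  by apply: eq_bigr => i _; exact: GH.
rewrite {2}/D mulr_sumr; apply: eq_big_seq => i.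
by rewrite mem_iota add1n ltnS => /andP[i0 im]; rewrite gauss_sum_mul// i0 leqW.
Qed.

Lemma gauss_sum_mul0r x : U x -> G 0%N x * D x = 0.
Proof.
move=> Ux; have [_ /(_ x Ux)[DH _]] := gauss_sum_projection.
by rewrite -DH -(GH 0 Ux) -adjM gauss_sum_mul0// adj0.
Qed.

(** Stability of delta under d/dz. *)
Lemma gauss_sum_dz x : U x -> D x * dd D x = dd D x.
Proof.
move=> Ux; rewrite /D (del_sum oU)// -/(D x) mulr_sumr.
apply: eq_big_seq => i; rewrite mem_iota add1n ltnS => /andP[i0 im].
rewrite dzG// mulrA; congr (_ * _).
by rewrite mulrDr !gauss_sum_mul// ?i0 ?leqW.
Qed.

(** Together with [gauss_sum_dz], stability of psi under d/dz. *)
Lemma gauss_sum_dz0 x : U x -> (G 0%N x + D x) * dd (G 0%N) x = dd (G 0%N) x.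
Proof.
move=> Ux; rewrite dzG// mulrA; congr (_ * _).
rewrite mulrDr !mulrDl GG// gauss_sum_mul0// addr0.
by rewrite gauss_sum_mul// gauss_sequence_orth// add0r.
Qed.

(** The derivative by zbar lowers the index by at most one, so it may leave delta
    only through [G 0 = phi]. *)
Lemma gauss_sum_dzbar x : U x -> db D x = (G 0%N x + D x) * db D x.
Proof.
move=> Ux; rewrite /D (del_sum oU)// -/(D x) mulr_sumr.
apply: eq_big_seq => -[|i]; rewrite mem_iota// add1n ltnS => im.
rewrite dzbarG// mulrA; congr (_ * _).
have NG k : (k <= m)%N -> (G 0%N x + D x) * G k x = G k x.
  case: k => [|k] km; rewrite mulrDl.
    by rewrite GG// gauss_sum_mul0// addr0.
  by rewrite gauss_sequence_orth// add0r gauss_sum_mul//= ltnS ltnW.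
by rewrite mulrDr !NG// ltnW.
Qed.

(** Adjoint form of [gauss_sum_dzbar]: the z-derivative of the projection onto
    delta vanishes on the complement of psi, and on delta by [gauss_sum_dz], hence
    reduces to its block from phi to delta. *)
Lemma gauss_sum_dz_link x : U x -> dd D x = - (D x * dd (G 0%N) x).
Proof.
move=> Ux; have pD := gauss_sum_projection.
rewrite -(del_orth oU _ gauss_sum_Cinfty (UG 0) gauss_sum_mul0 Ux).
have := congr1 (fun A => adj A) (gauss_sum_dzbar Ux).
rewrite adjM (adj_dzbar oU pD Ux) adjD GH// (pD.2 x Ux).1 => {1}->.
have : dd D x * D x = 0.
  have := del_idem oU (- 'i%C) pD Ux.
  by rewrite gauss_sum_dz// => /eqP; rewrite -subr_eq subrr eq_sym => /eqP.
by rewrite mulrDr => ->; rewrite addr0.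
Qed.

End GaussSequence.

(** * Smoothness in the loop parameter *)

Section Composition.
Context {R : realType} {V W : normedModType R}.
Variables (L : V -> W) (U : set W).
Hypothesis L_line : forall (h : R) v x, L (h *: v + x) = h *: L v + L x.
Hypothesis L_cont : continuous L.

Lemma Ck_comp_linear k (f : W -> R) : Ck k U f -> Ck k (L @^-1` U) (f \o L).
Proof.
have quotientE (g : W -> R) x v :
    (fun h : R => h^-1 *: (((g \o L) \o shift x) (h *: v) - (g \o L) x)) =
    (fun h : R => h^-1 *: ((g \o shift (L x)) (h *: L v) - g (L x))).
  by apply/funext => h /=; rewrite L_line.
have cf (g : W -> R) x : {for L x, continuous g} -> {for x, continuous (g \o L)}.
  by move=> cg; apply: continuous_comp => //; exact: L_cont.
elim: k f => [|k IH] f kf.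
  by split=> // x Ux; apply: cf; exact: Ck_continuous kf Ux.
apply: CkS => [x Ux|v x Ux|v].
- by apply: cf; exact: Ck_continuous kf Ux.
- by rewrite /derivable quotientE; exact: Ck_derivable kf Ux.
- suff -> : 'D_v (f \o L) = 'D_(L v) f \o L by exact/IH/Ck_derive.
  by apply/funext => x; rewrite /derive quotientE.
Qed.

Lemma mx_Cinfty_comp_linear m n (F : W -> 'M[R[i]]_(m, n)) :
  mx_Cinfty U F -> mx_Cinfty (L @^-1` U) (fun x => F (L x)).
Proof.
move=> UF a b; split=> k; first exact: (Ck_comp_linear ((UF a b).1 k)).
exact: (Ck_comp_linear ((UF a b).2 k)).
Qed.

End Composition.

Section Trigonometric.
Context {R : realType}.

(** [Ck] on the line involves derivatives along every vector [v] of [R], not only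
    along 1. *)
Lemma derive_scale (f : R -> R) (x v : R) : derivable f x 1 ->
  derivable f x v /\ 'D_v f x = v * 'D_1 f x.
Proof.
move=> df; have dif : differentiable f x by exact/derivable1_diffP.
split; first exact: diff_derivable.
by rewrite deriveE// deriv1E// -derive1E.
Qed.

Lemma Ck_cos_sin k :
  Ck k setT (cos : R -> R) /\ Ck k setT (sin : R -> R).
Proof.
elim: k => [|k [IHc IHs]].
  by split; split=> // x _; [exact: continuous_cos|exact: continuous_sin].
have ck (c : R) f : Ck k setT f -> Ck k setT (fun x => c * f x).
  by move=> kf; exact: (CkM openT (Ck_cst k setT c) kf).
split; apply: CkS => [x _|v x _|v].
- exact: continuous_cos.
- by have [] := derive_scale v (@ex_derive _ _ _ _ _ _ _ (is_derive_cos x)).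
- have -> : 'D_v (cos : R -> R) = fun x => - v * sin x.
    apply/funext => x.
    have [_ ->] := derive_scale v (@ex_derive _ _ _ _ _ _ _ (is_derive_cos x)).
    by rewrite (@derive_val _ _ _ _ _ _ _ (is_derive_cos x)) mulrN mulNr.
  exact: ck.
- exact: continuous_sin.
- by have [] := derive_scale v (@ex_derive _ _ _ _ _ _ _ (is_derive_sin x)).
- have -> : 'D_v (sin : R -> R) = fun x => v * cos x.
    apply/funext => x.
    have [_ ->] := derive_scale v (@ex_derive _ _ _ _ _ _ _ (is_derive_sin x)).
    by rewrite (@derive_val _ _ _ _ _ _ _ (is_derive_sin x)).
  exact: ck.
Qed.

End Trigonometric.

Section Loops.
Context {R : realType}.
Local Notation C := R[i].

Lemma mx_Cinfty_scale {V : normedModType R} m n (U : set V) (f : V -> C)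
    (F : V -> 'M[C]_(m, n)) : open U -> cCinfty U f -> mx_Cinfty U F ->
  mx_Cinfty U (fun x => f x *: F x).
Proof.
move=> oU Uf UF a b; apply: cCinfty_open_eq (cCinftyM oU Uf (UF a b)) => //.
by move=> x _; rewrite mxE.
Qed.

(** Negative powers of the loop parameter are smooth in the angle since the
    inverse is the conjugate on the unit circle. *)
Lemma expi_inv (t : R) : (cos t +i* sin t : C)^-1 = cos t -i* sin t.
Proof.
have n0 : cos t +i* sin t != 0 :> C.
  rewrite eq_complex /=; apply/negP => /andP[/eqP c0 /eqP s0].
  have := cos2Dsin2 t; rewrite c0 s0 expr0n /= addr0 => /eqP.
  by rewrite eq_sym oner_eq0.
apply: (mulIf n0); rewrite mulVf//; apply/eqP; rewrite eq_complex !(ReM, ImM) /=.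
by rewrite mulNr opprK -!expr2 cos2Dsin2 eqxx mulNr mulrC subrr eqxx.
Qed.

Lemma cCinfty_expi_inv (W : set (R * R)) :
  cCinfty [set x : R * (R * R) | W x.2] (fun x => (cos x.1 +i* sin x.1 : C)^-1).
Proof.
have e : (fun x : R * (R * R) => (cos x.1 +i* sin x.1 : C)^-1) =
    fun x => cos x.1 -i* sin x.1 by apply/funext => x; rewrite expi_inv.
have comp k (f : R -> R) : Ck k setT f ->
    Ck k [set: R * (R * R)] (f \o (fun x : R * (R * R) => x.1)).
  by apply: Ck_comp_linear => // x; exact: cvg_fst.
rewrite e; split=> k; apply: (@Ck_subset _ _ k _ setT) => //=.
  exact: (comp k cos (Ck_cos_sin k).1).
have := CkM openT (Ck_cst k setT (-1)) (comp k sin (Ck_cos_sin k).2).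
by apply: Ck_open_eq => [|x _]; [exact: openT|rewrite /= mulN1r].
Qed.

Lemma open_snd (W : set (R * R)) : open W -> open [set x : R * (R * R) | W x.2].
Proof.
move=> oW; apply: (@open_comp _ _ (fun x : R * (R * R) => x.2) W) => // x _.
exact: cvg_snd.
Qed.

Lemma mx_Cinfty_snd n (W : set (R * R)) (F : R * R -> 'M[C]_n) :
  mx_Cinfty W F -> mx_Cinfty [set x : R * (R * R) | W x.2] (fun x => F x.2).
Proof.
move=> WF.
apply: (@mx_Cinfty_comp_linear _ _ _ (fun x : R * (R * R) => x.2)) => // x.
exact: cvg_snd.
Qed.

Lemma mx_Cinfty_loop n (W : set (R * R)) (D P E : R * R -> 'M[C]_n) : open W ->
  mx_Cinfty W D -> mx_Cinfty W P -> mx_Cinfty W E ->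
  mx_Cinfty [set x : R * (R * R) | W x.2] (fun x =>
    D x.2 + (cos x.1 +i* sin x.1)^-1 *: P x.2 + (cos x.1 +i* sin x.1) ^- 2 *: E x.2).
Proof.
move=> oW WD WP WE; have oW2 := open_snd oW.
have We := cCinfty_expi_inv W.
apply: (mx_CinftyD oW2 (mx_CinftyD oW2 (mx_Cinfty_snd WD)
  (mx_Cinfty_scale oW2 We (mx_Cinfty_snd WP)))).
apply: (mx_Cinfty_scale oW2 _ (mx_Cinfty_snd WE)).
have := cCinftyM oW2 We We; congr cCinfty.
by apply/funext => x; rewrite -expr2 exprVn.
Qed.

End Loops.

(** * The logarithmic derivative of the loop *)

Section LoopAlgebra.
Context {C : numFieldType} {n : nat}.
Implicit Types D P d p b q : 'M[C]_n.
Variables (l : C) (D P : 'M[C]_n).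
Hypotheses (l0 : l != 0) (DP : D * P = 0) (PD : P * D = 0).
(* [D], [P] and [E] are the projections onto delta, phi and the complement of psi. *)
Let E := 1 - D - P.

Let mxscaleAr (a : C) (A B : 'M[C]_n) : A * (a *: B) = a *: (A * B).
Proof. by rewrite [RHS]scalemxAr. Qed.

Let mxscaleAl (a : C) (A B : 'M[C]_n) : a *: A * B = a *: (A * B).
Proof. by rewrite [RHS]scalemxAl. Qed.

(** With [d] and [p] the derivatives of [D] and [P] by z, the hypotheses say that
    delta and psi are stable under d/dz and that there is no block from the
    complement of psi to delta.  The left side is the logarithmic derivative of
    the loop, whose inverse is its first factor. *)
Lemma loop_dz d p : D * d = d -> (P + D) * p = p -> d = - (D * p) ->
  (D + l *: P + l ^+ 2 *: E) * (d + l^-1 *: p + l ^- 2 *: - (d + p)) =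
  (1 - l^-1) *: ((P - (1 - P)) * p).
Proof.
move=> Dd PDp dE; set X := d + _ + _.
have Pp : P * p = p - D * p by rewrite -{2}PDp mulrDl addrK.
have Pd : P * d = 0 by rewrite -Dd mulrA PD mul0r.
have DX : D * X = d + l^-1 *: (D * p) + l ^- 2 *: - (d + D * p).
  by rewrite /X !mulrDr !mxscaleAr mulrN mulrDr Dd.
have PX : P * X = l^-1 *: (P * p) + l ^- 2 *: - (P * p).
  by rewrite /X !mulrDr !mxscaleAr mulrN mulrDr Pd !add0r.
have EX : E * X = 0.
  have Ed : E * d = 0 by rewrite /E !mulrBl mul1r Dd Pd subrr subr0.
  have Ep : E * p = 0 by rewrite /E !mulrBl mul1r Pp subrr.
  by rewrite /X !mulrDr !mxscaleAr mulrN mulrDr Ed Ep !(addr0, oppr0, scaler0).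
rewrite !mulrDl !mxscaleAl DX PX EX scaler0 addr0 mulNr mulrBl mul1r Pp dE.
move: (D * p) => u; apply/matrixP => i j; rewrite !mxE; field.
exact: l0.
Qed.

(** The hypotheses are the adjoints of those of [loop_dz], followed by the Leibniz
    rule for the identities D D = D, P P = P, P D = 0 and D P = 0. *)
Lemma loop_dzbar b q : b * D = b -> q * (P + D) = q -> b = - (q * D) ->
  b = b * D + D * b -> q = q * P + P * q -> q * D = - (P * b) ->
  b * P = - (D * q) ->
  (D + l *: P + l ^+ 2 *: E) * (b + l^-1 *: q + l ^- 2 *: - (b + q)) =
  (1 - l) *: ((P - (1 - P)) * q).
Proof.
move=> bD qPD bE bL qL qDE bPE; set X := b + _ + _.
have Db : D * b = 0.
  by move/eqP: bL; rewrite bD -subr_eq0 opprD addrA subrr add0r oppr_eq0 => /eqP.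
have Pb : P * b = b by rewrite [RHS]bE qDE opprK.
have Pq : P * q = - b.
  by rewrite bE opprK; apply: (addrI (q * P)); rewrite -qL -mulrDr qPD.
have Dq : D * q = 0 by rewrite -[D * q]opprK -bPE -bD -mulrA DP mulr0 oppr0.
have DX : D * X = 0.
  by rewrite /X !mulrDr !mxscaleAr mulrN mulrDr Db Dq !(addr0, oppr0, scaler0).
have PX : P * X = b - l^-1 *: b.
  rewrite /X !mulrDr !mxscaleAr mulrN mulrDr Pb Pq subrr oppr0.
  by rewrite scaler0 addr0 scalerN.
have EX : E * X = l^-1 *: (q + b) - l ^- 2 *: (q + b).
  have Eb : E * b = 0 by rewrite /E !mulrBl mul1r Db Pb subr0 subrr.
  have Eq : E * q = q + b by rewrite /E !mulrBl mul1r Dq Pq subr0 opprK.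
  by rewrite /X !mulrDr !mxscaleAr mulrN mulrDr Eb Eq !add0r scalerN.
rewrite !mulrDl !mxscaleAl DX PX EX mulNr mulrBl mul1r Pq.
apply/matrixP => i j; rewrite !mxE; field.
exact: l0.
Qed.

End LoopAlgebra.

(** * Coordinates on the surface *)

Section Charts.
Context {R : realType}.
Local Notation C := R[i].

Lemma R2_of_CK (z : C) : C_of_R2 (R2_of_C z) = z.
Proof. by case: z. Qed.

Lemma C_of_R2K (x : R * R) : R2_of_C (C_of_R2 x) = x.
Proof. by case: x. Qed.

Lemma C_of_R2_continuous : continuous (@C_of_R2 R).
Proof.
move=> x; apply/cvgrPdist_lt => e e0.
have [e1 eE] : exists e1 : R, e = e1%:C.
  by exists (complex.Re e); rewrite RRe_real// gtr0_real.
have e10 : 0 < e1 by rewrite -ltcR -eE.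
have : \forall y \near x, ball x (e1 / 2) y by apply: nbhsx_ballx; rewrite divr_gt0.
apply: filterS => y [/= b1 b2]; rewrite eE.
have -> : C_of_R2 x - C_of_R2 y = (x.1 - y.1)%:C + 'i%C * (x.2 - y.2)%:C.
  by rewrite [RHS](_ : _ = (x.1 - y.1) +i* (x.2 - y.2)) // [RHS]complexE.
apply: le_lt_trans (ler_normD _ _) _.
rewrite normrM (_ : `|'i%C| = 1) ?mul1r; last first.
  by rewrite normc_def /= expr0n /= add0r expr1n sqrtr1.
by rewrite !normc_def /= expr0n /= !addr0 !sqrtr_sqr -rmorphD ltcR (splitr e1) ltrD.
Qed.

Context {M : topologicalType} (c : chart R M).

Lemma chart_imageE : [set R2_of_C (Defs.coord c p) | p in dom c] =
  C_of_R2 @^-1` (Defs.coord c @` dom c).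
Proof.
apply/seteqP; split=> [x [p dp <-]|x [p dp xE]] /=.
  by rewrite R2_of_CK; exists p.
by exists p => //; rewrite xE C_of_R2K.
Qed.

(** The chart is a homeomorphism onto an open subset of the plane, so a property
    that holds off isolated points of the surface does so in coordinates. *)
Lemma near_chart (p : M) (S : M -> Prop) : dom c p ->
  (\forall q \near p^', S q) ->
  \forall y \near (R2_of_C (Defs.coord c p))^', S (icoord c (C_of_R2 y)).
Proof.
move=> dp nS; set x := R2_of_C _.
have cx : Defs.coord c p = C_of_R2 x by rewrite R2_of_CK.
have icx : icoord c (C_of_R2 x) = p by rewrite -cx coordK.
have cont : {for x, continuous (fun y => icoord c (C_of_R2 y))}.
  apply: continuous_comp; first exact: C_of_R2_continuous.
  by apply: icoord_continuous; exists p.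
have nU : \forall y \near x, (Defs.coord c @` dom c) (C_of_R2 y).
  apply: (@C_of_R2_continuous x); apply: open_nbhs_nbhs; split.
    exact: codom_open.
  by exists p.
have nS' : \forall y \near x, icoord c (C_of_R2 y) <> p -> S (icoord c (C_of_R2 y)).
  have nSp : \forall q \near p, q <> p -> S q.
    have nSp : nbhs p [set q | q != p -> S q] := nS.
    by apply: (filterS _ nSp) => q qS qp; apply: qS; apply/eqP.
  by move: cont; rewrite /prop_for /continuous_at icx => /(_ _ nSp).
have key : \forall y \near x, y != x -> S (icoord c (C_of_R2 y)).
  apply: filterS2 nU nS' => y [q dq qE] yS yx; apply: yS => ip.
  move/eqP: yx; apply; rewrite -[y]C_of_R2K -[x]C_of_R2K; congr R2_of_C.
  by rewrite -cx -qE -ip -qE coordK.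
exact: key.
Qed.

End Charts.

(** * Orthogonal vectors and Hermitian projections *)

Section OrthogonalVectors.
Context {C : numClosedFieldType} {n : nat}.
Local Notation adj A := (A ^t*)%sesqui.

Lemma adj_mul_self_eq0 (v : 'cV[C]_n) : (adj v *m v) 0 0 = 0 -> v = 0.
Proof.
rewrite mxE => /eqP; rewrite psumr_eq0 => [/allP v0|i _]; last first.
  by rewrite !mxE mulrC -normCK exprn_ge0.
apply/colP => i; have /implyP := v0 i (mem_index_enum i).
by rewrite !mxE mulrC -normCK expf_eq0 /= normr_eq0 => /(_ isT)/eqP.
Qed.

(** The Gram matrix of the family is invertible of size n + 1 but has rank at most
    n. *)
Lemma no_orthogonal_family (w : 'I_n.+1 -> 'cV[C]_n) :
  (forall i, w i != 0) -> (forall i j, i != j -> adj (w i) *m w j = 0) -> False.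
Proof.
move=> w0 worth; pose W : 'M[C]_(n, n.+1) := \matrix_(i, j) w j i 0.
have WW i j : (adj W *m W) i j = (adj (w i) *m w j) 0 0.
  by rewrite !mxE; apply: eq_bigr => k _; rewrite !mxE.
have WD : adj W *m W = diag_mx (\row_i (adj (w i) *m w i) 0 0).
  apply/matrixP => i j; rewrite WW [RHS]mxE; have [<-|ij] := eqVneq i j.
    by rewrite mulr1n [RHS]mxE.
  by rewrite mulr0n worth// [LHS]mxE.
have : adj W *m W \in unitmx.
  rewrite WD unitmxE det_diag unitfE; apply/prodf_neq0 => i _; rewrite mxE.
  by apply/eqP => /adj_mul_self_eq0/eqP; exact/negP.
move/mxrank_unit => rk; have := leq_trans (mxrankM_maxr (adj W) W) (rank_leq_row W).
by rewrite rk ltnn.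
Qed.

End OrthogonalVectors.

Section HermitianProjections.
Context {R : realType} {n : nat}.
Local Notation C := R[i].
Local Notation adj A := (A ^t*)%sesqui.
Implicit Types a b : {vspace 'cV[C]_n}.

Lemma hproj_adj a : adj (hproj a) = hproj a.
Proof. by case: (hproj_spec a). Qed.

Lemma hproj_idem a : hproj a * hproj a = hproj a.
Proof. by case: (hproj_spec a). Qed.

Lemma hprojP a (v : 'cV[C]_n) : v \in a <-> hproj a *m v = v.
Proof. by case: (hproj_spec a). Qed.

Lemma hproj_mem a (v : 'cV[C]_n) : hproj a *m v \in a.
Proof. by apply/hprojP; rewrite mulmxA [hproj a *m hproj a]hproj_idem. Qed.

Lemma eq_mx_col p q (A B : 'M[C]_(p, q)) :
  (forall v : 'cV[C]_q, A *m v = B *m v) -> A = B.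
Proof.
move=> AB; apply/matrixP => i j.
by have /matrixP/(_ i 0) := AB (delta_mx j 0); rewrite -!colE !mxE.
Qed.

Lemma hproj_orth a b : orthogonal_spaces a b -> hproj a * hproj b = 0.
Proof.
move=> ab; apply: eq_mx_col => v; rewrite mul0mx -mulmxE -mulmxA.
set w := hproj b *m v; set u := hproj a *m w; apply: adj_mul_self_eq0.
have ua : u \in a by exact: hproj_mem.
have -> : adj u *m u = adj (hproj a *m u) *m w.
  have -> : adj (hproj a *m u) = adj u *m hproj a.
    by rewrite trmx_mul map_mxM -[in LHS]/(adj (hproj a)) hproj_adj.
  by rewrite -mulmxA.
by rewrite ((hprojP _ _).1 ua) ab ?hproj_mem// mxE.
Qed.

Lemma hproj_dim0 a : \dim a = 0%N -> hproj a = 0.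
Proof.
move/eqP; rewrite dimv_eq0 => /eqP a0; apply: eq_mx_col => v; rewrite mul0mx.
by have := hproj_mem a v; rewrite {2}a0 memv0 => /eqP.
Qed.

Lemma dim_neq0P a : \dim a != 0%N -> exists2 v, v \in a & v != 0.
Proof.
by rewrite dimv_eq0 -vpick0 => a0; exists (vpick a) => //; exact: memv_pick.
Qed.

End HermitianProjections.

(** * Gauss bundles in a chart *)

Section Surface.
Context {R : realType} {M : riemann_surface R} {n : nat}.
Local Notation C := R[i].
Local Notation adj A := (A ^t*)%sesqui.
Implicit Types (c : chart R M) (phi psi : M -> {vspace 'cV[C]_n}).

Lemma chart_image_open c : open (chart_image c).
Proof.
rewrite /chart_image chart_imageE; apply: open_comp; last exact: codom_open.
by move=> x _; exact: C_of_R2_continuous.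
Qed.

Lemma chart_image_coord c p : dom c p -> chart_image c (R2_of_C (Defs.coord c p)).
Proof. by move=> dp; exists p. Qed.

Lemma local_expr_coord {T} c (F : M -> T) p : dom c p ->
  local_expr c F (R2_of_C (Defs.coord c p)) = F p.
Proof. by move=> dp; rewrite /local_expr R2_of_CK coordK. Qed.

Lemma icoord_dom c y : chart_image c y ->
  dom c (icoord c (C_of_R2 y)) /\ R2_of_C (Defs.coord c (icoord c (C_of_R2 y))) = y.
Proof. by move=> [p dp <-]; rewrite R2_of_CK coordK. Qed.

Definition local_proj c phi : R * R -> 'M[C]_n :=
  local_expr c (fun p => hproj (phi p)).

Lemma hproj_cartan (a : {vspace 'cV[C]_n}) : hproj a = 2^-1 *: (cartan a + 1%:M).
Proof. by apply/matrixP => i j; rewrite /cartan !mxE; field. Qed.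

Lemma hproj_smooth k phi : subbundle k phi -> smooth (fun p => hproj (phi p)).
Proof.
move=> [_ sphi] c ac; have oU := @chart_image_open c.
apply: mx_Cinfty_open_eq (mx_CinftyZ (2^-1) oU
  (mx_CinftyD oU (sphi c ac) (mx_Cinfty_cst _ 1%:M))) => // x _.
by rewrite /local_expr hproj_cartan.
Qed.

Lemma local_proj_projection k c phi : subbundle k phi -> atlas c ->
  projection_field (chart_image c) (local_proj c phi).
Proof.
move=> sphi ac; split=> [|x _]; first exact: hproj_smooth sphi c ac.
by split; [exact: hproj_adj|exact: hproj_idem].
Qed.

(** Differentiating [s = P s] gives [(1 - P) d s = (d P) P s]: the value at [q]
    depends on the section only through its value there. *)
Lemma second_ffE k c phi s q : subbundle k phi -> atlas c ->
  smooth_section phi s -> dom c q ->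
  second_ff c phi s q =
  del (- 'i%C) (local_proj c phi) (R2_of_C (Defs.coord c q)) *m hproj (phi q) *m s q.
Proof.
move=> sphi ac [ss sin] dq; have Uq := chart_image_coord dq.
set y := R2_of_C _ in Uq *; have oU := @chart_image_open c.
have Us := ss c ac; have pP := local_proj_projection sphi ac.
have PE : local_proj c phi y = hproj (phi q) by exact: local_expr_coord.
have sE : local_expr c s y = s q by exact: local_expr_coord.
have dsE : del (- 'i%C) (local_expr c s) y =
    del (- 'i%C) (local_proj c phi) y *m s q +
    hproj (phi q) *m del (- 'i%C) (local_expr c s) y.
  rewrite -PE -sE -(delM oU _ pP.1 Us Uq).
  apply: (del_open_eq oU) Uq => z _.
  by rewrite /local_proj /local_expr; apply/esym/hprojP.
rewrite /second_ff /dz DzE -/y mulmxBl mul1mx {1}dsE addrK.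
by rewrite -mulmxA (hprojP _ _).1.
Qed.

(** One inclusion tests the definition of the Gauss bundle on the sections
    [P v], with [v] a constant vector; for the other, each column of the
    projection onto [psi q] is of the form [second_ff c phi s q], and [X] has the
    vectors [s q] as its columns. *)
Lemma gauss_bundle_step k c phi psi : subbundle k phi -> gauss_bundle phi psi ->
  atlas c -> gauss_step (chart_image c) (local_proj c phi) (local_proj c psi).
Proof.
move=> sphi [[m spsi] gb] ac x [p dp <-].
have oU := @chart_image_open c.
have nU := near_punctured_open oU (chart_image_coord dp).
have pP := local_proj_projection sphi ac.
apply: filterS2 (near_chart dp (gb p)) nU => y Sy Uy.
have [dq yE] := icoord_dom Uy; set q := icoord c (C_of_R2 y) in Sy dq yE.
have := Sy c ac dq => imE; rewrite -[local_proj c psi y]/(hproj (psi q)).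
have PE : local_proj c phi y = hproj (phi q) by [].
set a := del _ _ y; have aE := del_idem oU (- 'i%C) pP Uy.
have ffE s : smooth_section phi s -> second_ff c phi s q = a *m hproj (phi q) *m s q.
  by move=> ss; rewrite (second_ffE sphi ac ss dq) yE.
split.
  apply: eq_mx_col => v; rewrite PE -!mulmxE -mulmxA; apply/hprojP.
  pose s p := hproj (phi p) *m v.
  have ss : smooth_section phi s.
    split=> [d ad|r]; last exact: hproj_mem.
    apply: mx_CinftyM (hproj_smooth sphi ad) (mx_Cinfty_cst _ v).
    exact: chart_image_open.
  suff : [set w | w \in psi q] (a *m hproj (phi q) *m v) by [].
  rewrite imE; exists s => //; rewrite ffE// -!mulmxA.
  by rewrite /s (mulmxA _ _ v) [_ *m hproj (phi q)]hproj_idem.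
have ex j : exists w : 'cV[C]_n, hproj (psi q) *m delta_mx j 0 = a *m hproj (phi q) *m w.
  have : [set w | w \in psi q] (hproj (psi q) *m (delta_mx j 0 : 'cV[C]_n)).
    exact: hproj_mem.
  by rewrite imE => -[s ss sE]; exists (s q); rewrite -ffE.
have [w wE] := choice ex; exists (\matrix_(i, j) w j i 0).
apply/matrixP => i j; have /matrixP/(_ i 0) := wE j.
rewrite -colE mxE PE => ->; rewrite -!mulmxE !mxE; apply: eq_bigr => r _.
by rewrite !mxE.
Qed.

End Surface.

(** * The harmonic map equation for a projection *)

Section CartanCalculus.
Context {R : realType} {M : riemann_surface R} {n k : nat}.
Local Notation C := R[i].
Local Notation adj A := (A ^t*)%sesqui.
Variables (phi : M -> {vspace 'cV[C]_n}) (sphi : subbundle k phi).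
Variables (c : chart R M) (ac : atlas c).
Let U := chart_image c.
Let oU : open U := @chart_image_open R M c.
Let P := local_proj c phi.
Let pP : projection_field U P := local_proj_projection sphi ac.
Let UP : mx_Cinfty U P := pP.1.

Lemma cartan_mulK (a : {vspace 'cV[C]_n}) : cartan a * cartan a = 1.
Proof.
have PK : hproj a * cartan a = hproj a.
  by rewrite /cartan !mulrBr mulr1 hproj_idem subrr subr0.
rewrite {1}/cartan !mulrBl PK mul1r /cartan.
by apply/matrixP => i j; rewrite !mxE; ring.
Qed.

Lemma invmx_cartan (a : {vspace 'cV[C]_n}) : invmx (cartan a) = cartan a.
Proof.
have aa : cartan a *m cartan a = 1%:M by exact: cartan_mulK.
by have [ua _] := mulmx1_unit aa; rewrite -[RHS](mulKmx ua) aa mulmx1.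
Qed.

Lemma del_cartan u y : U y ->
  del u (local_expr c (fun p => cartan (phi p))) y = 2 *: del u P y.
Proof.
move=> Uy; have U1 : mx_Cinfty U (cst (- 1%:M : 'M[C]_n)) := mx_Cinfty_cst _ _.
have -> : local_expr c (fun p => cartan (phi p)) = fun y => 2 *: P y + (- 1%:M).
  apply/funext => z; rewrite /P /local_proj /local_expr /cartan.
  by apply/matrixP => i j; rewrite !mxE; ring.
rewrite (delD u (mx_CinftyZ 2 oU UP) U1 Uy) (del_cst u (- 1%:M : 'M[C]_n)) addr0.
exact: (delZ oU u 2 UP Uy).
Qed.

(** Harmonicity of the involution [2 p - 1] in terms of [p]; [h] is the mixed
    second derivative of [p].  The first hypothesis is the second derivative of
    [p p = p], the second one the harmonic map equation; eliminating
    [b a + a b] leaves the commutation. *)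
Lemma cartan_laplace_commute (p a b h : 'M[C]_n) :
  h = h * p + b * a + (a * b + p * h) ->
  2 *: b * a + (p - (1 - p)) * h + (2 *: a * b + (p - (1 - p)) * h) = 0 ->
  h * p = p * h.
Proof.
have scale2 (F G : 'M[C]_n) : 2 *: F * G = 2 *: (F * G).
  by rewrite -mulmxE scalemxAl.
have -> : (p - (1 - p)) * h = p * h - (h - p * h) by rewrite !mulrBl mul1r.
rewrite !scale2; move: (h * p) (b * a) (a * b) (p * h) => F G H J hE.
move/matrixP => e; apply/matrixP => i j.
move: (e i j) (congr1 (fun A : 'M[C]_n => A i j) hE).
rewrite !mxE; move: (F i j) (G i j) (H i j) (J i j) (h i j) => f g k0 l m e0 e1.
have two_neq0 : (2 : C) != 0 by rewrite pnatr_eq0.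
apply/eqP; rewrite -subr_eq0; apply/eqP/(mulfI two_neq0); rewrite mulr0.
rewrite -[RHS]oppr0 -e0 e1; ring.
Qed.

Let half_double (A B : 'M[C]_n) : 2^-1 *: (A *m (2 *: B)) = A * B.
Proof. by rewrite -scalemxAr scalerA mulVf ?scale1r// pnatr_eq0. Qed.

Lemma Az_cartan p : dom c p ->
  Az c (fun p => cartan (phi p)) p =
  cartan (phi p) * del (- 'i%C) P (R2_of_C (Defs.coord c p)).
Proof.
move=> dp; rewrite /Az invmx_cartan /dz DzE del_cartan ?half_double//.
exact: chart_image_coord.
Qed.

Lemma Azbar_cartan p : dom c p ->
  Azbar c (fun p => cartan (phi p)) p =
  cartan (phi p) * del 'i%C P (R2_of_C (Defs.coord c p)).
Proof.
move=> dp; rewrite /Azbar invmx_cartan /dzbar DzbarE del_cartan ?half_double//.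
exact: chart_image_coord.
Qed.

Lemma harmonic_map_field : harmonic_map (fun p => cartan (phi p)) ->
  harmonic_field U P.
Proof.
move=> [_ _ /(_ c ac) harm] x Ux; have [p dp xE] := Ux.
pose K y := local_expr c (fun p => cartan (phi p)) y.
have UK : mx_Cinfty U K by exact: sphi.2.
have UdP u : mx_Cinfty U (del u P) by exact: mx_Cinfty_del.
pose A u y := K y * del u P y.
have AzE : del 'i%C (local_expr c (Az c (fun p => cartan (phi p)))) x =
    del 'i%C (A (- 'i%C)) x.
  apply: (del_open_eq oU _ _ Ux) => y; rewrite inE => /icoord_dom[dy yE].
  by have := Az_cartan dy; rewrite yE.
have AzbarE : del (- 'i%C) (local_expr c (Azbar c (fun p => cartan (phi p)))) x =
    del (- 'i%C) (A 'i%C) x.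
  apply: (del_open_eq oU _ _ Ux) => y; rewrite inE => /icoord_dom[dy yE].
  by have := Azbar_cartan dy; rewrite yE.
have := harm p dp; rewrite /dzbar /dz DzbarE DzE xE AzE AzbarE.
rewrite !(del_mul oU _ UK (UdP _) Ux) !(del_cartan _ Ux).
rewrite (del_comm oU 'i%C (- 'i%C) UP Ux).
set a := del (- 'i%C) P x; set b := del 'i%C P x; set h := del (- 'i%C) _ x.
have -> : K x = P x - (1 - P x) by [].
have hE : h = h * P x + b * a + (a * b + P x * h).
  rewrite [LHS](_ : h = del (- 'i%C) (fun y =>
    del 'i%C P y * P y + P y * del 'i%C P y) x); last first.
    apply: (del_open_eq oU _ _ Ux) => y; rewrite inE => Uy.
    exact: (del_idem oU _ pP Uy).
  have UbP := mx_Cinfty_mul oU (UdP 'i%C) UP.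
  rewrite (delD _ UbP (mx_Cinfty_mul oU UP (UdP 'i%C)) Ux).
  by rewrite (del_mul oU _ (UdP 'i%C) UP Ux) (del_mul oU _ UP (UdP 'i%C) Ux).
exact: cartan_laplace_commute hE.
Qed.

End CartanCalculus.

(** * The extended solution *)

Section UnitonSolution.
Context {R : realType} {M : riemann_surface R} {n : nat}.
Local Notation C := R[i].
Local Notation adj A := (A ^t*)%sesqui.
Variables (G : nat -> M -> {vspace 'cV[C]_n}) (rk : nat -> nat).
Hypothesis sG : forall i, subbundle (rk i) (G i).
Hypothesis stepG : forall i, gauss_bundle (G i) (G i.+1).
Hypothesis harmG : harmonic_map (fun p => cartan (G 0%N p)).
Hypothesis orthG : forall i p, (1 <= i)%N -> orthogonal_spaces (G 0%N p) (G i p).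

Section InChart.
Variables (c : chart R M) (ac : atlas c).

Definition chart_seq i := local_proj c (G i).

Lemma chart_seq_projection i : projection_field (chart_image c) (chart_seq i).
Proof. exact: local_proj_projection (sG i) ac. Qed.

Lemma chart_seq_step i : gauss_step (chart_image c) (chart_seq i) (chart_seq i.+1).
Proof. exact: gauss_bundle_step (sG i) (stepG i) ac. Qed.

Lemma chart_seq_harmonic : harmonic_field (chart_image c) (chart_seq 0%N).
Proof. exact: (harmonic_map_field (sG 0%N) ac harmG). Qed.

Lemma chart_seq_orth0 j x : (0 < j)%N -> chart_image c x ->
  chart_seq 0%N x * chart_seq j x = 0.
Proof. by move=> j0 _; apply: hproj_orth; exact: orthG. Qed.

End InChart.

Lemma gauss_spaces_orth i j p : i != j -> hproj (G i p) * hproj (G j p) = 0.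
Proof.
move=> ij; have [c ac dp] := atlas_cover p.
have := gauss_sequence_orth (@chart_image_open _ _ c) (chart_seq_projection ac)
  (chart_seq_step ac) (chart_seq_harmonic ac) (@chart_seq_orth0 c) ij
  (chart_image_coord dp).
by rewrite /chart_seq /local_proj !local_expr_coord.
Qed.

(** The ranks are constant on the surface, so a single point decides which bundles
    vanish. *)
Lemma gauss_sequence_stops : exists m, forall p, hproj (G m.+1 p) = 0.
Proof.
have [p _] := rs_nonempty M.
suff [m m0] : exists m, rk m.+1 = 0%N.
  by exists m => q; apply: hproj_dim0; rewrite (sG m.+1).1.
apply: contrapT => nstop.
have vex (i : 'I_n.+1) : exists v, v \in G i.+1 p /\ v != 0.
  have [|v vG v0] := @dim_neq0P R n (G i.+1 p); last by exists v.
  by rewrite (sG i.+1).1; apply/eqP => ri; apply: nstop; exists i.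
have [w wP] := choice vex.
apply: (@no_orthogonal_family _ n w) => [i|i j ij]; first by have [] := wP i.
have [[/hprojP <- _] [/hprojP <- _]] := (wP i, wP j).
rewrite trmx_mul map_mxM hproj_adj -mulmxA (mulmxA (hproj _)).
rewrite [hproj _ *m hproj _]gauss_spaces_orth ?mul0mx ?mulmx0// eqSS.
Qed.

Variables (m : nat) (Gm0 : forall p, hproj (G m.+1 p) = 0).

(** The coefficients of l^0, l^-1 and l^-2 in the loop are the projections onto
    delta, phi and the complement of psi. *)
Definition uniton_high p := \sum_(i <- iota 1 m) hproj (G i p).
Local Notation D := uniton_high.
Definition uniton_mid p := hproj (G 0%N p).
Local Notation P := uniton_mid.
Definition uniton_low p := 1 - D p - P p.
Local Notation E := uniton_low.
Definition uniton_loop (l : C) p := D p + l^-1 *: P p + l ^- 2 *: E p.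
Local Notation Phi := uniton_loop.

Lemma uniton_sum p : D p + P p + E p = 1.
Proof. by rewrite [LHS]addrC /uniton_low -(addrA 1) -opprD subrK. Qed.

Lemma uniton_algebra p : [/\ D p * D p = D p, P p * P p = P p, D p * P p = 0 &
  P p * D p = 0] /\ (adj (D p) = D p /\ adj (P p) = P p).
Proof.
have [c ac dp] := atlas_cover p; have Up := chart_image_coord dp.
have oU := @chart_image_open _ _ c.
have pG := chart_seq_projection ac.
have G0 x : chart_image c x -> chart_seq c m.+1 x = 0 by move=> _; exact: Gm0.
have [pD1 pD2] := gauss_sum_projection oU pG (chart_seq_step ac)
  (chart_seq_harmonic ac) (@chart_seq_orth0 c) G0.
have [aD DD] := pD2 _ Up.
have DP := gauss_sum_mul0 oU pG (chart_seq_step ac)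
  (chart_seq_harmonic ac) (@chart_seq_orth0 c) m Up.
have PD := gauss_sum_mul0r oU pG (chart_seq_step ac)
  (chart_seq_harmonic ac) (@chart_seq_orth0 c) G0 Up.
have DE : gauss_sum (chart_seq c) m (R2_of_C (Defs.coord c p)) = D p.
  apply: eq_bigr => i _; exact: local_expr_coord.
have PE : chart_seq c 0%N (R2_of_C (Defs.coord c p)) = P p by exact: local_expr_coord.
rewrite DE in aD DD; rewrite DE PE in DP PD.
split; split=> //; [exact: hproj_idem|exact: hproj_adj].
Qed.

Lemma uniton_E p : [/\ E p * E p = E p, D p * E p = 0, E p * D p = 0,
  P p * E p = 0 & E p * P p = 0].
Proof.
have [[DD PP DP PD] _] := uniton_algebra p.
have DE : D p * E p = 0 by rewrite !mulrBr mulr1 DD DP subrr subr0.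
have PE : P p * E p = 0 by rewrite !mulrBr mulr1 PD PP subr0 subrr.
have ED : E p * D p = 0 by rewrite !mulrBl mul1r DD PD subrr subr0.
have EP : E p * P p = 0 by rewrite !mulrBl mul1r DP PP subr0 subrr.
by split=> //; rewrite {1}/uniton_low !mulrBl mul1r DE PE !subr0.
Qed.

Lemma uniton_loop_adj l p : `|l| = 1 ->
  adj (Phi l p) = D p + l *: P p + l ^+ 2 *: E p.
Proof.
move=> l1; have [_ [aD aP]] := uniton_algebra p.
have aE : adj (E p) = E p by rewrite !linearB /= !map_mxB trmx1 map_mx1 aD aP.
have adjZ (a : C) (A : 'M[C]_n) : adj (a *: A) = a^*%R *: adj A.
  by rewrite linearZ /= map_mxZ.
have lV : (l^-1)^*%R = l by rewrite invC_norm l1 expr1n invr1 mul1r conjCK.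
by rewrite /Phi !adjD !adjZ aD aP aE -exprVn rmorphXn /= lV.
Qed.

Lemma uniton_loop_mul l p : l != 0 ->
  Phi l p * (D p + l *: P p + l ^+ 2 *: E p) = 1.
Proof.
move=> l0; have [[DD PP DP PD] _] := uniton_algebra p.
have [EE DE ED PE EP] := uniton_E p.
have mulZl (a : C) (A B : 'M[C]_n) : a *: A * B = a *: (A * B).
  by rewrite -mulmxE scalemxAl.
have mulZr (a : C) (A B : 'M[C]_n) : A * (a *: B) = a *: (A * B).
  by rewrite -mulmxE scalemxAr.
rewrite /Phi !mulrDl !mulZl !mulrDr !mulZr DD PP EE DP PD DE ED PE EP.
rewrite !(scaler0, addr0, add0r) !scalerA mulVf// mulVf ?expf_neq0// !scale1r.
exact: uniton_sum.
Qed.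

Lemma uniton_loop_unitary l p : `|l| = 1 -> Phi l p \is unitarymx.
Proof.
move=> l1; apply/unitarymxP; rewrite uniton_loop_adj//.
by apply: uniton_loop_mul; rewrite -normr_eq0 l1 oner_eq0.
Qed.

Lemma uniton_smooth : [/\ smooth D, smooth P & smooth E].
Proof.
have sD : smooth D.
  move=> c ac; have oU := @chart_image_open _ _ c.
  exact: (mx_Cinfty_sum _ oU (fun i => hproj_smooth (sG i) ac)).
have sP : smooth P by exact: hproj_smooth (sG 0%N).
split=> // c ac; have oU := @chart_image_open _ _ c.
apply: (mx_CinftyB oU _ (sP c ac)).
by apply: (mx_CinftyB oU _ (sD c ac)); exact: mx_Cinfty_cst.
Qed.

Lemma uniton_loop_del u l c y : atlas c -> chart_image c y ->
  del u (local_expr c (Phi l)) y =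
  del u (local_expr c D) y + l^-1 *: del u (local_expr c P) y +
  l ^- 2 *: - (del u (local_expr c D) y + del u (local_expr c P) y).
Proof.
move=> ac Uy; have oU := @chart_image_open _ _ c.
have [/(_ c ac) sD /(_ c ac) sP /(_ c ac) sE] := uniton_smooth.
have sZP := mx_CinftyZ l^-1 oU sP; have sZE := mx_CinftyZ (l ^- 2) oU sE.
have delE : del u (local_expr c E) y =
    - (del u (local_expr c D) y + del u (local_expr c P) y).
  have := delD u sE (mx_CinftyD oU sD sP) Uy.
  rewrite (delD u sD sP Uy) => e; apply/eqP; rewrite -addr_eq0 -e.
  rewrite -(del_cst u (1%:M : 'M[C]_n) y).
  apply/eqP/(del_open_eq oU _ _ Uy) => z _; rewrite /local_expr /uniton_low /=.
  by rewrite -(addrA 1) -opprD subrK.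
rewrite (delD u (mx_CinftyD oU sD sZP) sZE Uy) (delD u sD sZP Uy).
by rewrite (delZ oU u _ sP Uy) (delZ oU u _ sE Uy) delE.
Qed.

Lemma uniton_extended_solution :
  extended_solution (fun p => cartan (G 0%N p)) Phi.
Proof.
have [sD sP sE] := uniton_smooth; split.
- move=> c ac.
  exact: (mx_Cinfty_loop (@chart_image_open _ _ c) (sD c ac) (sP c ac) (sE c ac)).
- exact: uniton_loop_unitary.
- move=> p; rewrite /Phi invr1 expr1n invr1 !scale1r.
  exact: uniton_sum.
move=> c ac l p l1 dp; have l0 : l != 0 by rewrite -normr_eq0 l1 oner_eq0.
rewrite invmx_unitary ?uniton_loop_unitary// uniton_loop_adj//.
have Up := chart_image_coord dp; have oU := @chart_image_open _ _ c.
rewrite (Az_cartan (sG 0%N) ac dp) (Azbar_cartan (sG 0%N) ac dp) /dz /dzbar.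
rewrite DzE DzbarE !uniton_loop_del//; set y := R2_of_C _ in Up *.
have G0 x : chart_image c x -> chart_seq c m.+1 x = 0 by move=> _; exact: Gm0.
have pG := chart_seq_projection ac; have stG := chart_seq_step ac.
have hG := chart_seq_harmonic ac; have oG := @chart_seq_orth0 c.
have pD := gauss_sum_projection oU pG stG hG oG G0.
have DDz := gauss_sum_dz oU pG stG hG oG G0 Up.
have NPz := gauss_sum_dz0 oU pG stG hG oG G0 Up.
have link := gauss_sum_dz_link oU pG stG hG oG G0 Up.
have [[DD PP DP PD] [aD aP]] := uniton_algebra p.
have DE : gauss_sum (chart_seq c) m y = D p.
  by apply: eq_bigr => i _; exact: local_expr_coord.
have PE : chart_seq c 0%N y = P p by exact: local_expr_coord.
have KE : cartan (G 0%N p) = P p - (1 - P p) by [].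
rewrite KE -[local_expr c D]/(gauss_sum (chart_seq c) m).
rewrite -[local_expr c P]/(chart_seq c 0%N) -/(chart_seq c 0%N).
rewrite DE PE in DDz NPz link.
have bE := del_idem oU 'i%C pD Up; have qE := del_idem oU 'i%C (pG 0%N) Up.
rewrite DE PE in bE qE.
have PDx x : chart_image c x -> chart_seq c 0%N x * gauss_sum (chart_seq c) m x = 0.
  exact: (gauss_sum_mul0r oU pG stG hG oG G0).
have DPx x : chart_image c x -> gauss_sum (chart_seq c) m x * chart_seq c 0%N x = 0.
  exact: (gauss_sum_mul0 oU pG stG hG oG).
have qD := del_orth oU 'i%C (pG 0%N).1 pD.1 PDx Up.
have bP := del_orth oU 'i%C pD.1 (pG 0%N).1 DPx Up.
rewrite DE PE in qD bP.
split; first exact: (loop_dz l0 PD DDz NPz link).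
have ad := adj_dz oU pD Up; have ap := adj_dz oU (pG 0%N) Up.
have bD := congr1 (fun A : 'M[C]_n => adj A) DDz; rewrite adjM ad aD in bD.
have qN := congr1 (fun A : 'M[C]_n => adj A) NPz; rewrite adjM adjD ap aD aP in qN.
have adjN (A : 'M[C]_n) : adj (- A) = - adj A by rewrite linearN /= map_mxN.
have bq : del 'i%C (gauss_sum (chart_seq c) m) y =
    - (del 'i%C (chart_seq c 0%N) y * D p).
  by rewrite -ad link adjN adjM ap aD.
exact: (loop_dzbar l0 DP bD qN bq bE qE qD bP).
Qed.

Lemma uniton_trigonometric : trigonometric_polynomial Phi.
Proof.
have [sD sP sE] := uniton_smooth.
exists 2%N, 0%N, (fun j => if j is j'.+1 then if j' is 0 then P else D else E).
split=> [[|[|j]]|l p l1] //.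
have l2 : l ^ (0%:Z - 2%:Z) = l ^- 2 by [].
have l1' : l ^ (1%:Z - 2%:Z) = l^-1 by [].
have l0 : l ^ (2%:Z - 2%:Z) = 1 by [].
rewrite addn0 !big_nat_recr//= big_geq// add0r l2 l1' l0 scale1r.
by rewrite [RHS]addrC (addrC (l ^- 2 *: E p)) addrA.
Qed.

End UnitonSolution.

Theorem proposition4p9 (R : realType) (M : riemann_surface R) (n k : nat)
    (phi : M -> {vspace 'cV[R[i]]_n}) :
  subbundle k phi ->
  harmonic_map (fun p => cartan (phi p)) ->
  strongly_isotropic phi ->
  finite_uniton_number (fun p => cartan (phi p)).
Proof.
move=> sphi harm [G [G0 stepG] orthG]; subst phi.
have /choice[rk sG] : forall i, exists r, subbundle r (G i).
  by case=> [|i]; [exists k|have [] := stepG i].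
have [m Gm0] := gauss_sequence_stops sG stepG harm orthG.
exists (uniton_loop G m); last exact: (uniton_trigonometric sG m).
exact: (uniton_extended_solution sG stepG harm orthG Gm0).
Qed.
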